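(* A spacelike surface $M$ in $\mathbb{R}^4_1$ is strongly marginally trapped and totally $(\boldsymbol{n}^T,\boldsymbol{n}^S)$-umbilical if and only if, up to rigid motions of $\mathbb{R}^4_1$, $M$ is given by $$\boldsymbol{X}_f(u_1,u_2)=(f(u_1,u_2),f(u_1,u_2),u_1,u_2)$$ for a harmonic function $f:\mathbb{R}^2\to\mathbb{R}$.
   Context: $\mathbb{R}^4_1$ is $\mathbb{R}^4$ with the pseudo scalar product $\langle \boldsymbol{x},\boldsymbol{y}\rangle_1=-x_0y_0+x_1y_1+x_2y_2+x_3y_3$. A nonzero vector $\boldsymbol{x}$ is spacelike, timelike or lightlike if $\langle \boldsymbol{x},\boldsymbol{x}\rangle_1$ is $>0$, $<0$ or $=0$ respectively. Let $\boldsymbol{e}_0=(1,0,0,0)$ and $\|\boldsymbol{x}\|_1=\sqrt{|\langle\boldsymbol{x},\boldsymbol{x}\rangle_1|}$. The wedge product $\boldsymbol{x}_1\wedge\boldsymbol{x}_2\wedge\boldsymbol{x}_3$ is the vector determined by $\langle\boldsymbol{x},\boldsymbol{x}_1\wedge\boldsymbol{x}_2\wedge\boldsymbol{x}_3\rangle_1=\det(\boldsymbol{x},\boldsymbol{x}_1,\boldsymbol{x}_2,\boldsymbol{x}_3)$ for all $\boldsymbol{x}$. A spacelike surface is $M=\boldsymbol{X}(U)$, where $U\subset\mathbb{R}^2$ is open and $\boldsymbol{X}:U\to\mathbb{R}^4_1$ is a smooth embedding all of whose tangent planes $T_pM$ consist (apart from $0$) of spacelike vectors; $M$ is identified with $U$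 via $\boldsymbol{X}$. A future directed normal frame is a pair $(\boldsymbol{n}^T,\boldsymbol{n}^S)$ of smooth normal fields along $M$ where $\boldsymbol{n}^T$ is unit timelike, future directed ($\langle\boldsymbol{n}^T,\boldsymbol{e}_0\rangle_1<0$), and $\boldsymbol{n}^S=\dfrac{\boldsymbol{n}^T\wedge\boldsymbol{X}_{u_1}\wedge\boldsymbol{X}_{u_2}}{\|\boldsymbol{n}^T\wedge\boldsymbol{X}_{u_1}\wedge\boldsymbol{X}_{u_2}\|_1}$ (unit spacelike, orthogonal to $\boldsymbol{n}^T$). Let $\pi^t:T_p\mathbb{R}^4_1=T_pM\oplus N_p(M)\to T_pM$ be the orthogonal projection. Shape operators on $T_pM$: $S_p(\boldsymbol{n}^T)=-\pi^t\circ d_p\boldsymbol{n}^T$, $S_p(\boldsymbol{n}^S)=-\pi^t\circ d_p\boldsymbol{n}^S$, $S_p(\boldsymbol{n}^T,\pm\boldsymbol{n}^S)=-\pi^t\circ d_p(\boldsymbol{n}^T\pm\boldsymbol{n}^S)$. The mean curvature vector is $\mathfrak{H}(p)=\frac12\mathrm{Trace}\,S_p(\boldsymbol{n}^T)\,\boldsymbol{n}^T+\frac12\mathrm{Trace}\,S_p(\boldsymbol{n}^S)\,\boldsymbol{n}^S$. $M$ is strongly marginally trapped if $\mathfrak{H}(p)=\boldsymbol{0}$ at every $p\in M$. $M$ is totally $(\boldsymbol{n}^T,\boldsymbol{n}^S)$-umbilical if at every $p\in M$ the operator $S_p(\boldsymbol{n}^T,\boldsymbol{n}^S)$ (sign $+$)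 is a scalar multiple of the identity of $T_pM$.
   Formalization: f is harmonic on an open subset of R^2, not on all of R^2; M is given by X_f (up to reparametrization) near each point, with one rigid motion per connected component; rigid motion and parameter change together must reverse orientation, since X_f itself has the opposite n^S. *)

(* Defs.v *)
From HB Require Import structures.
From mathcomp Require Import all_boot all_order all_algebra.
From mathcomp Require Import all_classical all_reals all_analysis.

Set Implicit Arguments.
Unset Strict Implicit.
Unset Printing Implicit Defensive.
Import Order.TTheory GRing.Theory Num.Theory.
Import numFieldNormedType.Exports.
Local Open Scope classical_set_scope.
Local Open Scope ring_scope.

Section Minkowski.
Variable R : realType.
Implicit Types x y z w : 'rV[R]_4.

Definition basis_vec n (i : 'I_n) : 'rV[R]_n := delta_mx 0 i.

Definition eta : 'M[R]_4 := diag_mx (\row_i (if i == 0 then -1 else 1)).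

Definition mink x y : R := (x *m eta *m y^T) 0 0.

Lemma minkE x y :
  mink x y = - (x 0 0 * y 0 0) + x 0 1 * y 0 1
             + x 0 2%:R * y 0 2%:R + x 0 3%:R * y 0 3%:R.
Proof.
rewrite /mink /eta mul_mx_diag mxE !big_ord_recl big_ord0 !mxE /= addr0.
rewrite mulrN1 mulNr !mulr1 !addrA.
by congr (_ + x 0 _ * y 0 _ + x 0 _ * y 0 _ + x 0 _ * y 0 _); apply: val_inj.
Qed.

Definition spacelike x : Prop := x != 0 /\ 0 < mink x x.

Definition mink_norm x : R := Num.sqrt `|mink x x|.

Definition det4 x y z w : R :=
  \det (col_mx x (col_mx y (col_mx z w)) : 'M[R]_(1 + (1 + (1 + 1)))).

(* The coordinate formula for the wedge product; [wedgeP] is its defining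
   property. *)
Definition wedge x y z : 'rV[R]_4 :=
  \row_i (eta i i * det4 (basis_vec i) x y z).

Lemma det4_row x y z w :
  det4 x y z w = \sum_i x 0 i * det4 (basis_vec i) y z w.
Proof.
rewrite /det4 (expand_det_row _ (0 : 'I_4)).
apply: eq_bigr => i _; rewrite (expand_det_row _ (0 : 'I_4)).
have E0 (v : 'rV[R]_4) (B : 'M[R]_(3, 4)) j :
  (col_mx v B : 'M[R]_4) 0 j = v 0 j.
  have -> : (0 : 'I_4) = lshift 3 (0 : 'I_1) by apply: val_inj.
  by rewrite (col_mxEu v B).
have Ec (v : 'rV[R]_4) (B : 'M[R]_(3, 4)) j :
  cofactor (col_mx v B : 'M[R]_4) 0 j = cofactor (col_mx (0 : 'rV[R]_4) B : 'M[R]_4) 0 j.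
  congr (_ * \det _); apply/matrixP => k l; rewrite !mxE.
  case: splitP => // k' /= Ek.
  by exfalso; move: Ek; rewrite /= /bump leq0n ord1.
rewrite E0 (bigD1 i) //= big1 => [|j ji].
  rewrite E0 mxE !eqxx mul1r addr0; congr (_ * _).
  by rewrite Ec [RHS]Ec.
by rewrite E0 mxE eqxx (negbTE ji) mul0r.
Qed.

Lemma wedgeP x y z w :
  w = wedge x y z <-> forall v, mink v w = det4 v x y z.
Proof.
have eta2 i : eta i i * eta i i = 1.
  by rewrite !mxE eqxx mulr1n; case: ifP; rewrite ?mulrNN mulr1.
have mE v u : mink v u = \sum_i v 0 i * (eta i i * u 0 i).
  rewrite /mink /eta mul_mx_diag mxE; apply: eq_bigr => i _.
  by rewrite !mxE eqxx mulr1n mulrA.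
split=> [-> v|H].
  rewrite mE det4_row; apply: eq_bigr => i _.
  by rewrite [wedge _ _ _ _ _]mxE (mulrA (eta i i)) eta2 mul1r.
apply/rowP => i; rewrite [RHS]mxE -H mE (bigD1 i) //= big1 => [|j ji].
  by rewrite [basis_vec i _ _]mxE !eqxx mul1r addr0 mulrA eta2 mul1r.
by rewrite [basis_vec i _ _]mxE eqxx (negbTE ji) mul0r.
Qed.

(* [x |-> x *m A + b] with [lorentz A] is the general isometry of R^4_1. *)
Definition lorentz (A : 'M[R]_4) : Prop := A *m eta *m A^T = eta.

Lemma lorentzP (A : 'M[R]_4) :
  lorentz A -> forall x y, mink (x *m A) (y *m A) = mink x y.
Proof. by move=> AL x y; rewrite /mink trmx_mul !mulmxA -!(mulmxA x) AL. Qed.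

End Minkowski.

Section Smooth.
Variables (R : realType) (V : normedModType R).

(* For [U] open: all iterated directional derivatives up to order [k] exist
   and are continuous on [U].  Values outside [U] are irrelevant. *)
Fixpoint Ck (k : nat) (U : set 'rV[R]_2) (f : 'rV[R]_2 -> V) : Prop :=
  match k with
  | 0 => forall u, U u -> {for u, continuous f}
  | k'.+1 => (forall u, U u -> differentiable f u) /\
             (forall v : 'rV[R]_2, Ck k' U (fun u => 'D_v f u))
  end.

Definition smooth_on (U : set 'rV[R]_2) (f : 'rV[R]_2 -> V) : Prop :=
  forall k, Ck k U f.

End Smooth.

Section Surface.
Variable R : realType.
Implicit Types (U W D : set 'rV[R]_2) (X n nT : 'rV[R]_2 -> 'rV[R]_4).

Definition harmonic_on D (f : 'rV[R]_2 -> R) : Prop :=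
  Ck 2 D f /\
  forall v, D v ->
    \sum_(i < 2) 'D_(basis_vec R i) (fun w => 'D_(basis_vec R i) f w) v = 0.

Definition smooth_embedding U X : Prop :=
  [/\ smooth_on U X,
      forall u, U u -> row_free ('J X u),
      {in U &, injective X} &
      forall W, open W -> W `<=` U ->
        exists2 O : set 'rV[R]_4, open O & X @` W = X @` U `&` O].

(* The rows of ['J X u] are X_{u_1} and X_{u_2}, so its row space is T_pM. *)
Definition spacelike_surface U X : Prop :=
  [/\ open U, smooth_embedding U X &
      forall u, U u -> forall x : 'rV[R]_4,
        (x <= 'J X u)%MS -> x != 0 -> spacelike x].

Definition normal_to X u (x : 'rV[R]_4) : Prop :=
  forall y : 'rV[R]_4, (y <= 'J X u)%MS -> mink x y = 0.

Definition future_timelike_normal U X nT : Prop :=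
  smooth_on U nT /\
  forall u, U u ->
    [/\ normal_to X u (nT u),
        mink (nT u) (nT u) = -1 &
        mink (nT u) (basis_vec R 0) < 0].

Definition spacelike_normal X nT (u : 'rV[R]_2) : 'rV[R]_4 :=
  let w := wedge (nT u) ('D_(basis_vec R 0) X u) ('D_(basis_vec R 1) X u) in
  (mink_norm w)^-1 *: w.

(* [kermx (eta *m ('J X u)^T)] is the space of the x with <x, y>_1 = 0 for
   every y in T_pM. *)
Definition tangent_proj X u : 'M[R]_4 :=
  proj_mx <<'J X u>>%MS (kermx (eta R *m ('J X u)^T)).

(* The matrix of - pi^t \o d_p n in the basis (X_{u_1}, X_{u_2}) of T_pM,
   acting on rows of coefficients; see [shape_opP]. *)
Definition shape_op X n u : 'M[R]_2 :=
  - ('J n u *m tangent_proj X u) *m pinvmx ('J X u).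

Lemma shape_opP X n u (v : 'rV[R]_2) :
  v *m shape_op X n u *m 'J X u = - ('d n u v *m tangent_proj X u).
Proof.
rewrite /shape_op -mulmxA mulmxKpV; last first.
  by rewrite -mulNmx (submx_trans (proj_mx_sub _ _ _)) // genmxE.
by rewrite mulmxN mulmxA /jacobian mul_rV_lin1.
Qed.

Definition mean_curvature_vector X nT (u : 'rV[R]_2) : 'rV[R]_4 :=
  (2^-1 * \tr (shape_op X nT u)) *: nT u +
  (2^-1 * \tr (shape_op X (spacelike_normal X nT) u)) *: spacelike_normal X nT u.

Definition strongly_marginally_trapped U X nT : Prop :=
  forall u, U u -> mean_curvature_vector X nT u = 0.

Definition totally_umbilical U X nT : Prop :=
  forall u, U u ->
    exists k : R, shape_op X (fun w => nT w + spacelike_normal X nT w) u = k%:M.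

Definition graph_surface (f : 'rV[R]_2 -> R) (v : 'rV[R]_2) : 'rV[R]_4 :=
  \row_(i < 4) nth 0 [:: f v; f v; v 0 0; v 0 1] i.

Definition parameter_change W D (phi : 'rV[R]_2 -> 'rV[R]_2) : Prop :=
  [/\ smooth_on W phi, set_bij W D phi &
      forall u, W u -> 'J phi u \in unitmx].

(* Near [q], the rigid motion [x |-> x *m A + b] carries the surface to
   [graph_surface f] with [f] harmonic, up to a change of parameters [phi].
   The sign condition fixes the orientation: n^S depends on the orientation
   of the parameters and of R^4.  With [wedge] as above, f = 0, X the graph
   itself and n^T = e_0 one gets n^S = - e_1, so that for the graph in its own
   parameters it is n^T - n^S, not n^T + n^S, that is proportional to the
   constant null normal (1, 1, 0, 0); an orientation-reversing [A] or [phi],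
   but not both, exchanges the two. *)
Definition harmonic_graph_near U X (A : 'M[R]_4) (b : 'rV[R]_4)
    (q : 'rV[R]_2) : Prop :=
  exists (W D : set 'rV[R]_2) (phi : 'rV[R]_2 -> 'rV[R]_2)
         (f : 'rV[R]_2 -> R),
    [/\ [/\ open W, W q & W `<=` U],
        open D /\ harmonic_on D f,
        parameter_change W D phi,
        forall u, W u -> X u *m A + b = graph_surface f (phi u) &
        forall u, W u -> \det A * \det ('J phi u) < 0].

End Surface.

(* Main.v *)
From HB Require Import structures.
Require Import Defs.
From mathcomp Require Import all_boot all_order all_algebra.
From mathcomp Require Import all_classical all_reals all_analysis.
From mathcomp Require Import perm ring lra.

(** Let n = n^T + n^S. It is a null normal field, and in the Lorentzian normal
    plane the vectors orthogonal to n are exactly the multiples of n.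

    Suppose first that M is strongly marginally trapped and umbilical. Since
    n^T and n^S are linearly independent, the vanishing of the mean curvature
    vector means that S(n^T) and S(n^S) are both trace-free; hence so is
    S(n) = k Id, which gives k = 0 and S(n) = 0 ([null_shape_op0]). So every
    D_i n is normal to M, and it is orthogonal to n because <n, n> = 0;
    therefore D_i n is a multiple of n ([null_derive_parallel]). Dividing n by
    its time coordinate then yields a null field with zero derivative, equal on
    the connected component of p to a constant vector l, and <X, l> is constant
    there too, as l is normal ([null_direction_component]). A reflection takes
    l to (1, 1, 0, 0) ([null_rotation]) and a translation takes the component
    into the null hyperplane x_0 = x_1. On that hyperplane the pseudo scalar
    product of tangent vectors only sees the last two coordinates, so these
    coordinates have an invertible Jacobian along M, they are local parameters
    ([local_diffeomorphism]), and M is locally the graph of some f over them.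

    The link with harmonicity is one formula, valid for every such graph with
    coordinates phi and every normal field nu ([shape_op_graph]):
       S(nu) = <nu, l> J Hess(f) J^-1,   J the Jacobian matrix of phi.
    It holds because normality forces the last two coordinates of nu to be
    - <nu, l> grad f, which can be differentiated directly. Taking traces with
    nu = n^T, for which <n^T, l> is not 0, shows that the trapped condition
    makes f harmonic.

    Conversely the formula makes S(n^T) and S(n^S) trace-free when f is
    harmonic, and S(n) = 0 follows from <n, l> = 0. Being null and normal, l is
    proportional to n^T + n^S or to n^T - n^S; the identity
       det(l, n^T, X_1, X_2) det A = <n^T, l> det J     ([det4_graph])
    turns the sign condition on det A det J into the choice of the first case
    ([null_normal_orthogonal_sum]), and in the direct implication it proves
    that sign condition.

    The inverse function theorem rests on two facts: a 1/2-Lipschitz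
    perturbation of the identity is open, by Banach's fixed point theorem
    ([perturbed_identity]), and the mean value theorem, applied to each
    coordinate, bounds the difference between a C^1 map and its differential
    ([strong_differentiable]). *)

Set Implicit Arguments.
Unset Strict Implicit.
Unset Printing Implicit Defensive.
Import Order.TTheory GRing.Theory Num.Theory.
Import numFieldNormedType.Exports.
Local Open Scope classical_set_scope.
Local Open Scope ring_scope.

(** * Calculus of matrix-valued functions *)

Section Calculus.
Context {R : realType}.

Section Matrix_valued.
Context {V : normedModType R} {m n : nat}.
Implicit Types F : V -> 'M[R]_(m, n).

(** A matrix-valued map is the sum of its entries times the elementary
    matrices, so differentiability can be checked entrywise. *)
Lemma differentiable_mx F x :
  (forall i j, differentiable (fun y => F y i j) x) -> differentiable F x.
Proof.
move=> dF; have -> : F = \sum_(i < m) \sum_(j < n) (fun y => F y i j *: delta_mx i j).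
  apply/funext => y; rewrite fct_sumE {1}(matrix_sum_delta (F y)).
  by apply: eq_bigr => i _; rewrite fct_sumE.
by apply: differentiable_sum => i; apply: differentiable_sum => j;
  apply: differentiableZl.
Qed.

Lemma differentiable_entry F x i j :
  differentiable F x -> differentiable (fun y => F y i j) x.
Proof.
by move=> dF; apply: (differentiable_comp dF (differentiable_coord _ i j)).
Qed.

Lemma derive_entry F x v i j : differentiable F x ->
  ('D_v F x) i j = 'D_v (fun y => F y i j) x.
Proof. by move=> dF; rewrite derive_mx ?mxE//; apply: diff_derivable. Qed.

End Matrix_valued.

Section Affine.
Context {V : normedModType R} {m n p : nat}.
Variables (B : 'M[R]_(n, p)) (b : 'M[R]_(m, p)).

Lemma continuous_mulmxr : continuous (mulmxr B : 'M[R]_(m, n) -> 'M[R]_(m, p)).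
Proof.
move=> M; apply: differentiable_continuous; apply: differentiable_mx => i j.
have -> : (fun N : 'M[R]_(m, n) => mulmxr B N i j) =
          \sum_k ((B k j) \*: (fun N : 'M[R]_(m, n) => N i k)).
  by apply/funext => N; rewrite fct_sumE !mxE; apply: eq_bigr => k _; rewrite mulrC.
apply: differentiable_sum => k; apply: differentiableZ.
exact: differentiable_coord.
Qed.

Let linB (F : V -> 'M[R]_(m, n)) x : differentiable F x ->
  is_diff x (fun y => F y *m B) (fun v => 'd F x v *m B).
Proof.
move=> dF; apply: (@is_diff_comp _ _ _ _ F _ (mulmxr B) (mulmxr B)).
  exact: differentiableP.
apply: DiffDef; first exact/linear_differentiable/continuous_mulmxr.
by rewrite diff_lin //; apply: continuous_mulmxr.
Qed.

Lemma differentiable_affine (F : V -> 'M[R]_(m, n)) x : differentiable F x ->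
  differentiable (fun y => F y *m B + b) x.
Proof.
move=> dF; apply: differentiableD => //.
by have := linB dF; case.
Qed.

Lemma derive_affine (F : V -> 'M[R]_(m, n)) x v : differentiable F x ->
  'D_v (fun y => F y *m B + b) x = 'D_v F x *m B.
Proof.
move=> dF; have [dB eB] := linB dF.
rewrite (deriveD (f := fun y => F y *m B) (g := cst b)); last 2 first.
- exact: diff_derivable.
- exact: derivable_cst.
by rewrite derive_cst addr0 deriveE // eB deriveE.
Qed.

End Affine.

Section Mean_value.
Context {V : normedModType R}.

(** The one-variable theorem, along the segment from x to x + h. *)
Lemma mean_value (f : V -> R) (x h : V) :
  (forall t : R, 0 <= t <= 1 -> differentiable f (x + t *: h)) ->
  exists2 t : R, 0 <= t <= 1 & f (x + h) - f x = 'D_h f (x + t *: h).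
Proof.
move=> df; pose g (t : R) := f (x + t *: h).
have dg (t : R) : 0 <= t <= 1 -> is_diff t g (fun s => 'd f (x + t *: h) (s *: h)).
  move=> t01; apply: (is_diff_comp (f := fun t : R => x + t *: h)
    (df := fun s : R => s *: h)); last by apply: differentiableP; exact: df.
  by apply: is_diff_eq; rewrite add0r.
have Dg (t : R) : t \in `]0, 1[%R -> is_derive t 1 g ('D_h f (x + t *: h)).
  rewrite in_itv /= => /andP[/ltW t0 /ltW t1].
  have t01 : 0 <= t <= 1 by rewrite t0.
  have [d1 d2] := dg _ t01; apply: DeriveDef; first exact: diff_derivable.
  by rewrite deriveE // d2 scale1r deriveE //; exact: df.
have cg : {within `[0, 1], continuous g}.
  apply: derivable_within_continuous => t; rewrite in_itv /= => t01.
  by apply/derivable1_diffP; have [] := dg _ t01.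
have [t tin] := MVT_segment ler01 Dg cg.
rewrite /g scale1r scale0r addr0 subr0 mulr1 => E; exists t => //; rewrite in_itv /= in tin.
Qed.

Lemma ball_segment (q : V) r x y (t : R) : ball q r x -> ball q r y ->
  0 <= t <= 1 -> ball q r (x + t *: (y - x)).
Proof.
rewrite -ball_normE /ball_ /= => qx qy /andP[t0 t1].
have -> : q - (x + t *: (y - x)) = (1 - t) *: (q - x) + t *: (q - y).
  have -> : y - x = (q - x) - (q - y) by rewrite opprB [RHS]addrC addrA subrK.
  by rewrite opprD addrA scalerBr opprB scalerBl scale1r addrA addrAC.
have t1' : 0 <= 1 - t by rewrite subr_ge0.
apply: le_lt_trans (ler_normD _ _) _; rewrite !normrZ (ger0_norm t0) (ger0_norm t1').
have [->|tn0] := eqVneq t 0; first by rewrite subr0 mul1r mul0r addr0.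
have tp : 0 < t by rewrite lt_def tn0.
have -> : r = (1 - t) * r + t * r by rewrite -mulrDl subrK mul1r.
by rewrite ler_ltD ?ltr_pM2l// ler_wpM2l// ltW.
Qed.

Lemma derive0_cst_ball (f : V -> R) (q : V) (r : R) :
  (forall x, ball q r x -> differentiable f x) ->
  (forall x v, ball q r x -> 'D_v f x = 0) ->
  forall x y, ball q r x -> ball q r y -> f x = f y.
Proof.
move=> df Df0 x y bx by_.
have [t t01|t t01] := @mean_value f x (y - x).
  by apply: df; apply: ball_segment.
rewrite (addrC x) subrK Df0; last exact: ball_segment.
by move=> /eqP; rewrite subr_eq0 => /eqP.
Qed.

End Mean_value.

(** A property that is locally constant on an open set defines a relatively
    clopen part of it. Stating it for an arbitrary property allows constancy
    of one function to be used in proving constancy of another. *)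
Lemma locally_cst_component {T : topologicalType} (U : set T) (P : T -> Prop) p :
  open U ->
  (forall q, U q -> \forall x \near q, P x <-> P q) ->
  P p -> forall q, connected_component U p q -> P q.
Proof.
move=> oU locP Pp q pq.
have Up : U p by case: pq => C [Cp /(_ _ Cp)].
set K := connected_component U p.
have KU : (K `<=` U)%classic by apply: connected_component_sub.
have oP (Q : T -> Prop) : (forall q, U q -> \forall x \near q, Q x <-> Q q) ->
    open (U `&` [set x | Q x]).
  move=> lQ; rewrite openE => x [Ux Qx] /=.
  have nU : \forall y \near x, U y by apply: open_nbhs_nbhs.
  by apply: filterS2 nU (lQ x Ux) => y Uy [_ QyQx]; split=> //; exact: QyQx.
have : K `&` [set x | P x] = K.
  apply: (@component_connected _ U p).
  - by exists p; split=> //; apply: connected_component_refl.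
  - exists (U `&` [set x | P x]); first exact: oP.
    by rewrite setIA (setIidl KU).
  - exists (~` (U `&` [set x | ~ P x])).
      apply: open_closedC; apply: oP => x Ux.
      by apply: filterS (locP x Ux) => y [h1 h2]; split=> nP; [move/h2|move/h1].
    apply/seteqP; split=> x [Kx Px]; split=> //; first by case.
    by apply: contrapT => nPx; apply: Px; split=> //; exact: KU.
by move=> /seteqP[_ /(_ q pq)] [].
Qed.

End Calculus.

(** * Inverse function estimates *)

HB.instance Definition _ (R : realType) (m n : nat) :=
  Uniform_isComplete.Build 'M[R]_(m, n) (@mx_complete R m n).

Section Inverse_function.
Context {R : realType}.

Lemma entry_le_norm m n (M : 'M[R]_(m, n)) i j : `|M i j| <= `|M|.
Proof. by rewrite [leRHS]/Num.norm /= mx_normrE; apply: (le_bigmax _ _ (i, j)). Qed.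

Lemma norm_le_entries m n (M : 'M[R]_(m, n)) (e : R) :
  0 <= e -> (forall i j, `|M i j| <= e) -> `|M| <= e.
Proof.
by move=> e0 Me; rewrite [leLHS]/Num.norm /= mx_normrE bigmax_le // => -[i j] _; exact: Me.
Qed.

Lemma derive_basis {V : normedModType R} n (f : 'rV[R]_n -> V) u v :
  differentiable f u -> 'D_v f u = \sum_i v 0 i *: 'D_(basis_vec R i) f u.
Proof.
move=> df; rewrite deriveE // {1}(row_sum_delta v) linear_sum.
by apply: eq_bigr => i _; rewrite linearZ /= deriveE.
Qed.

(** Strict differentiability of a C^1 map: the linear approximation at q is
    uniformly good for all pairs of points near q, which is what contraction
    arguments need. *)
Lemma strong_differentiable n m (f : 'rV[R]_n -> 'rV[R]_m) q (e : R) : 0 < e ->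
  (\forall u \near q, differentiable f u) ->
  (forall i, {for q, continuous (fun u => 'D_(basis_vec R i) f u)}) ->
  \forall r \near 0^'+, forall x y, ball q r x -> ball q r y ->
    `|f y - f x - (y - x) *m 'J f q| <= e * `|y - x|.
Proof.
move=> e0 df cf; have e1 : 0 < e / n.+1%:R by rewrite divr_gt0.
have nD : \forall u \near q, forall i : 'I_n,
    `|'D_(basis_vec R i) f q - 'D_(basis_vec R i) f u| <= e / n.+1%:R.
  apply: (@filter_forall _ _ (fun i u => `|'D_(basis_vec R i) f q -
    'D_(basis_vec R i) f u| <= e / n.+1%:R) _ (nbhs_filter q)) => i.
  by move/cvgrPdist_le : (cf i); apply.
have /nbhs_ballP[r0 /= r00 H] : nbhs q [set u | differentiable f u /\ forall i : 'I_n,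
    `|'D_(basis_vec R i) f q - 'D_(basis_vec R i) f u| <= e / n.+1%:R].
  by near=> u; split; near: u.
near=> r => x y qx qy.
have rr0 : r <= r0 by near: r; apply: nbhs_right_le.
have sub z : ball q r z -> ball q r0 z by apply: le_ball.
apply: norm_le_entries => [|i j]; first by rewrite mulr_ge0 // ltW.
have dq : differentiable f q by have [] := H q (ballxx _ r00).
(* The intermediate point depends on the entry j; at that point each of the n
   partial derivatives contributes at most e / n.+1. *)
have [t t01|t t01] := @mean_value _ _ (fun u => f u i j) x (y - x).
  apply: (@differentiable_entry _ _ _ _ f).
  by have [] := H _ (sub _ (ball_segment qx qy t01)).
rewrite (addrC x) subrK.
set z := x + _ => E; have [dz Hz] := H z (sub _ (ball_segment qx qy t01)).
rewrite [leLHS](_ : _ = `|f y i j - f x i j - ((y - x) *m 'J f q) i j|); last by rewrite !mxE.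
rewrite E -derive_entry // -deriveEjacobian // !derive_basis //.
rewrite (_ : _ - _ = \sum_k (y - x) 0 k *
    ('D_(basis_vec R k) f z - 'D_(basis_vec R k) f q) i j); last first.
  have sumE (w : 'rV[R]_n) (F G : 'I_n -> 'rV[R]_m) :
      (\sum_k w 0 k *: F k) i j - (\sum_k w 0 k *: G k) i j =
      \sum_k w 0 k * (F k - G k) i j.
    by rewrite !summxE -sumrB; apply: eq_bigr => k _; rewrite !mxE mulrBr.
  exact: sumE.
apply: le_trans (ler_norm_sum _ _ _) _.
apply: (@le_trans _ _ (\sum_(k < n) `|y - x| * (e / n.+1%:R))).
  apply: ler_sum => k _; rewrite normrM ler_pM // ?entry_le_norm //.
  by apply: le_trans (entry_le_norm _ _ _) _; rewrite distrC.
rewrite sumr_const card_ord -mulrnAr mulrC ler_wpM2r // -[leLHS]mulr_natr.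
by rewrite -mulrA ler_piMr ?(ltW e0)// mulrC ler_pdivrMr ?mul1r ?ler_nat // ltr0n.
Unshelve. all: by end_near. Qed.

(** Solving f x = z is a fixed point problem for a contraction when f differs
    from the identity by a 1/2-Lipschitz map. *)
Lemma perturbed_identity {X : completeNormedModType R} (f : X -> X) (q : X) (r : R) :
  (forall x y, ball q r x -> ball q r y ->
     `|f y - f x - (y - x)| <= 2^-1 * `|y - x|) ->
  0 < r -> nbhs (f q) (f @` ball q r).
Proof.
move=> fE r0; have r20 : 0 < r / 2 by rewrite divr_gt0.
have r2r : r / 2 < r by rewrite ltr_pdivrMr // ltr_pMr // ltr1n.
apply/nbhs_ballP; exists (r / 2 / 2); first by rewrite /= divr_gt0.
move=> z; rewrite -ball_normE /ball_ /= => qz.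
pose B := [set x : X | `|q - x| <= r / 2].
pose T x := x - f x + z.
have Bb x : B x -> ball q r x.
  by move=> Bx; rewrite -ball_normE /ball_ /=; exact: le_lt_trans Bx r2r.
have Bq : B q by rewrite /B /= subrr normr0 ltW.
have TE x y : T y - T x = - (f y - f x - (y - x)).
  rewrite /T opprD addrACA subrr addr0 [- (x - f x)]opprD opprK.
  by rewrite addrACA [RHS]opprB [- f y + _]addrC opprB.
have TB : set_fun B B T.
  move=> x Bx; rewrite /B /=.
  have -> : q - T x = (q - T q) + - (T x - T q) by rewrite opprB addrA subrK.
  apply: le_trans (ler_normD _ _) _; rewrite normrN TE normrN.
  have -> : q - T q = f q - z by rewrite /T opprD opprB addrA addrCA subrr addr0.
  rewrite [leRHS]splitr lerD ?(ltW qz) //.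
  apply: le_trans (fE _ _ (Bb _ Bq) (Bb _ Bx)) _.
  by rewrite mulrC ler_wpM2r // distrC.
have iT := isFun.Build _ _ B B T TB.
pose TT : {fun B >-> B} := HB.pack T iT.
have cT : is_contraction TT.
  have h0 : (0 : R) <= 2^-1 by rewrite invr_ge0.
  exists (NngNum h0); split => /=; first by rewrite invf_lt1 // ltr1n.
  move=> [x y] [/= Bx By]; rewrite -[X in X <= _]normrN opprB TE normrN distrC -[y - x]opprB.
  rewrite opprB distrC.
  by have := fE _ _ (Bb _ Bx) (Bb _ By); rewrite [in X in _ <= X -> _]distrC.
have cB : closed B.
  exact: closed_closed_ball_.
have [x Bx] := banach_fixed_point cT cB (ex_intro _ q Bq).
rewrite /= /T -addrA => /eqP; rewrite -subr_eq0 opprD addrA subrr sub0r.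
rewrite opprD opprK subr_eq0 => /eqP fx.
by exists x => //; exact: le_lt_trans Bx r2r.
Qed.

(** Composing f with the inverse of its Jacobian matrix makes it a
    1/2-Lipschitz perturbation of the identity. The first bound gives
    injectivity and a Lipschitz inverse, the second openness. *)
Lemma local_inverse_bounds n (f : 'rV[R]_n -> 'rV[R]_n) (q : 'rV[R]_n) :
  (\forall u \near q, differentiable f u) ->
  (forall i, {for q, continuous (fun u => 'D_(basis_vec R i) f u)}) ->
  'J f q \in unitmx ->
  exists2 c : R, 0 < c & \forall r \near 0^'+,
    (forall x y, ball q r x -> ball q r y -> `|y - x| <= c * `|f y - f x|) /\
    nbhs (f q) (f @` ball q r).
Proof.
move=> df cf uJ; pose J := 'J f q.
have cJ : continuous (mulmxr (invmx J) : 'rV[R]_n -> 'rV[R]_n).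
  exact: continuous_mulmxr.
have [K K0 HK] := linear_lipschitz cJ.
have e0 : 0 < (2 * K)^-1 by rewrite invr_gt0 mulr_gt0.
exists (2 * K); first by rewrite mulr_gt0.
have Hn := strong_differentiable e0 df cf.
near=> r.
have r0 : 0 < r by near: r; apply: nbhs_right_gt.
have Hr0 : forall x y, ball q r x -> ball q r y ->
    `|f y - f x - (y - x) *m J| <= (2 * K)^-1 * `|y - x|.
  by near: r; exact: Hn.
have Hr x y : ball q r x -> ball q r y ->
    `|f y *m invmx J - f x *m invmx J - (y - x)| <= 2^-1 * `|y - x|.
  move=> qx qy; have := Hr0 x y qx qy.
  have -> : f y *m invmx J - f x *m invmx J - (y - x) =
            (f y - f x - (y - x) *m J) *m invmx J by rewrite !mulmxBl !mulmxK.
  move=> H.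
  apply: le_trans (HK _) _; rewrite -ler_pdivlMl //.
  by rewrite mulrA -invfM [K * _]mulrC.
split=> [x y qx qy|].
  have := Hr x y qx qy; rewrite -mulmxBl => {}Hr.
  have h := HK (f y - f x).
  have := ler_distD ((f y - f x) *m invmx J) (y - x) 0.
  rewrite !subr0 => h'; rewrite -mulrA -ler_pdivrMl //.
  rewrite distrC in Hr; move: h h' Hr => /=.
  set a := `|y - x|; set b := `|_ *m _|; set d := `|f y - f x|; set g := `|_ - _|.
  lra.
have H1 := @perturbed_identity 'rV[R]_n (fun x => f x *m invmx J) q r Hr r0.
have : nbhs (f q) (mulmxr (invmx J) @^-1`
   [set (fun x => f x *m invmx J) x | x in ball q r]) by apply: cJ.
apply: filterS => z [x qx /=] /(congr1 (mulmx^~ J)).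
by rewrite !mulmxKV // => <-; exists x.
Unshelve. all: by end_near. Qed.

End Inverse_function.

(** * Differentiability of the inverse and classes C^k *)

Section Differential_epsilon.
Context {R : realType} {V W : normedModType R}.

(** Epsilon form of differentiability, to build a differential by hand. *)
Lemma is_diff_littleo (f : V -> W) x (df : {linear V -> W}) : continuous df ->
  (forall e : R, 0 < e ->
     \forall h \near (0 : V), `|f (h + x) - f x - df h| <= e * `|h|) ->
  is_diff x f df.
Proof.
move=> cdf H; have E : f \o shift x = cst (f x) + df +o_ 0 id.
  apply/eqaddoP => e e0; have := H e e0.
  by apply: filterS => h; rewrite -addrA -opprD.
have D := diff_unique cdf E.
by apply: DiffDef => //; apply/diff_locallyP; rewrite D; split.
Qed.

Lemma diff_littleo (f : V -> W) x (e : R) : differentiable f x -> 0 < e ->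
  \forall h \near (0 : V), `|f (h + x) - f x - 'd f x h| <= e * `|h|.
Proof.
move=> /diff_locally /eqaddoP H e0; have := H e e0.
by apply: filterS => h; rewrite -addrA -opprD.
Qed.

Lemma near_eq_differentiable (f g : V -> W) x :
  (\forall y \near x, f y = g y) -> differentiable f x -> differentiable g x.
Proof.
move=> fg df; have fgx := nbhs_singleton fg.
suff [] : is_diff x g ('d f x) by [].
apply: is_diff_littleo => [|e e0]; first exact: diff_continuous.
have fg0 : \forall h \near 0, f (h + x) = g (h + x).
  by move: fg; rewrite (near_shift 0) /=; apply: filterS => h /=; rewrite subr0.
by apply: filterS2 fg0 (diff_littleo df e0) => h -> ; rewrite fgx.
Qed.

End Differential_epsilon.

(** The linearisation error of g at f u is the image under - J^-1 of the
    linearisation error of f at u; the Lipschitz bound turns its smallness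
    relative to x - u into smallness relative to f x - f u. *)
Lemma is_diff_inverse (R : realType) n (f g : 'rV[R]_n -> 'rV[R]_n)
    (W : set 'rV[R]_n) (c : R) u :
  0 < c -> W u -> differentiable f u -> 'J f u \in unitmx ->
  (forall x, W x -> `|x - u| <= c * `|f x - f u|) ->
  nbhs (f u) (f @` W) -> (forall x, W x -> g (f x) = x) ->
  is_diff (f u) g (mulmxr (invmx ('J f u))).
Proof.
move=> c0 Wu df uJ fc nf gf; set iJ := invmx _.
have ciJ : continuous (mulmxr iJ : 'rV[R]_n -> 'rV[R]_n) by exact: continuous_mulmxr.
have [K K0 HK] := linear_lipschitz ciJ.
apply: is_diff_littleo => // e e0.
have e1 : 0 < e / (K * c) by rewrite divr_gt0 // mulr_gt0.
have /nbhs_ballP[d /= d0 Hd] := diff_littleo df e1.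
have nh : \forall h \near (0 : 'rV[R]_n), (f @` W) (h + f u).
  have : \forall z \near f u, (f @` W) z by [].
  by rewrite (near_shift 0) /=; apply: filterS => h /=; rewrite subr0.
have nd : \forall h \near (0 : 'rV[R]_n), `|h| < d / c.
  by apply: nbhs0_lt; rewrite divr_gt0.
apply: filterS2 nh nd => h [w Ww fw] hd.
rewrite -fw !gf //.
have {fw} hE : h = f w - f u by rewrite fw addrK.
rewrite hE /= in hd *.
have wd : ball 0 d (w - u).
  rewrite -ball_normE /ball_ /= sub0r normrN (le_lt_trans (fc w Ww)) //.
  by rewrite mulrC -ltr_pdivlMr.
have dE : 'd f u (w - u) = (w - u) *m 'J f u by rewrite /jacobian mul_rV_lin1.
have := Hd _ wd; rewrite /= subrK dE; set E := f w - f u - _ => HE.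
have -> : w - u - (f w - f u) *m iJ = - (E *m iJ).
  by rewrite /E /iJ [in RHS]mulmxBl mulmxK // opprB.
rewrite normrN; apply: le_trans (HK _) _.
rewrite -ler_pdivlMl //; apply: le_trans HE _.
apply: le_trans (ler_wpM2l (ltW e1) (fc w Ww)) _.
have Kn : (K : R) != 0 by rewrite gt_eqF.
have cn : c != 0 by rewrite gt_eqF.
rewrite (_ : _ * (c * _) = K^-1 * (e * `|f w - f u|)) //.
by field; rewrite Kn cn.
Qed.

Section Ck_closure.
Context {R : realType}.
Implicit Types (U W : set 'rV[R]_2).

Section Vector.
Context {V : normedModType R}.
Implicit Types f g : 'rV[R]_2 -> V.

Lemma Ck_ext k U f g : open U -> (forall u, U u -> f u = g u) ->
  Ck k U f -> Ck k U g.
Proof.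
move=> oU; have near_fg f' g' u : (forall u, U u -> f' u = g' u) -> U u ->
    \forall w \near u, f' w = g' w :> V.
  by move=> fg Uu; apply: filterS (open_nbhs_nbhs (conj oU Uu)) => w /fg.
elim: k f g => [|k IH] f g fg /= => [cf u Uu|[df Df]].
  have nfg := near_fg _ _ _ fg Uu.
  suff : g @ u --> f u by rewrite (fg u Uu).
  apply: cvg_trans (cf u Uu).
  by apply: near_eq_cvg; [exact: nbhs_filter | exact: nfg].
split=> [u Uu|v]; first exact: near_eq_differentiable (near_fg _ _ _ fg Uu) (df u Uu).
by apply: IH (Df v) => u Uu; apply: near_eq_derive; exact: near_fg.
Qed.

Lemma Ck_continuous k U f : Ck k U f -> forall u, U u -> {for u, continuous f}.
Proof.
by case: k => [|k] //= [df _] u Uu; apply: differentiable_continuous; exact: df.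
Qed.

Lemma CkW k U f : Ck k.+1 U f -> Ck k U f.
Proof.
elim: k f => [|k IH] f [df Df]; first exact: (@Ck_continuous 1).
by split=> // v; apply: IH; exact: Df.
Qed.

Lemma Ck_sub k U W f : W `<=` U -> Ck k U f -> Ck k W f.
Proof.
move=> WU; elim: k f => [|k IH] f /= => [cf u /WU|[df Df]]; first exact: cf.
by split=> [u /WU|v]; [exact: df | exact: IH].
Qed.

Lemma Ck_cst k U (a : V) : Ck k U (fun=> a).
Proof.
elim: k a => [|k IH] a /=; first by move=> u _; exact: cst_continuous.
split=> [u _|v]; first exact: differentiable_cst.
have -> : (fun u => 'D_v (fun=> a) u) = (fun=> 0 : V) by apply/funext => u; exact: derive_cst.
exact: IH.
Qed.

Lemma CkD k U f g : open U -> Ck k U f -> Ck k U g -> Ck k U (fun u => f u + g u).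
Proof.
move=> oU; elim: k f g => [|k IH] f g /=.
  by move=> cf cg u Uu; apply: continuousD; [exact: cf | exact: cg].
move=> [df Df] [dg Dg]; split=> [u Uu|v].
  by apply: differentiableD; [exact: df | exact: dg].
apply: Ck_ext (IH _ _ (Df v) (Dg v)) => // u Uu.
by rewrite (deriveD (f := f) (g := g)) //; apply: diff_derivable; [exact: df | exact: dg].
Qed.

End Vector.

Implicit Types f g : 'rV[R]_2 -> R.

Lemma CkM k U f g : open U -> Ck k U f -> Ck k U g -> Ck k U (fun u => f u * g u).
Proof.
move=> oU; elim: k f g => [|k IH] f g.
  by move=> cf cg u Uu; apply: continuousM; [exact: cf | exact: cg].
move=> Cf Cg; have [[df Df] [dg Dg]] := (Cf, Cg); split=> [u Uu|v].
  by apply: differentiableM; [exact: df | exact: dg].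
apply: Ck_ext (CkD oU (IH _ _ (CkW Cf) (Dg v)) (IH _ _ (CkW Cg) (Df v))) => // u Uu.
by rewrite (deriveM (f := f) (g := g)) //; apply: diff_derivable; [exact: df | exact: dg].
Qed.

Lemma CkV k U f : open U -> (forall u, U u -> f u != 0) ->
  Ck k U f -> Ck k U (fun u => (f u)^-1).
Proof.
move=> oU f0; elim: k => [|k IH].
  by move=> cf u Uu; apply: continuousV; [exact: f0 | exact: cf].
move=> Cf; have Ci := IH (CkW Cf); have [df Df] := Cf; split=> [u Uu|v].
  by apply: differentiableV; [exact: df | exact: f0].
have C1 : Ck k U (fun=> -1 : R) by exact: Ck_cst.
apply: Ck_ext (CkM oU (CkM oU (CkM oU C1 Ci) Ci) (Df v)) => // u Uu.
rewrite deriveV ?f0 //; last by apply: diff_derivable; exact: df.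
by rewrite mulN1r mulNr -exprVn expr2.
Qed.

Lemma Ck_affine k U m n (F : 'rV[R]_2 -> 'rV[R]_m) (B : 'M[R]_(m, n)) b :
  open U -> Ck k U F -> Ck k U (fun u => F u *m B + b).
Proof.
move=> oU; elim: k F b => [|k IH] F b /=.
  move=> cF u Uu; apply: continuousD; last exact: cst_continuous.
  have /= := @continuous_mulmxr R 1 m n B (F u).
  apply: (@continuous_comp _ _ _ F (mulmxr B)).
  exact: cF.
move=> [dF DF]; split=> [u Uu|v].
  by apply: differentiable_affine; exact: dF.
apply: Ck_ext (IH _ 0 (DF v)) => // u Uu.
by rewrite addr0 derive_affine //; exact: dF.
Qed.

Lemma Ck_entry k U m n (F : 'rV[R]_2 -> 'M[R]_(m, n)) i j :
  open U -> Ck k U F -> Ck k U (fun u => F u i j).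
Proof.
move=> oU; elim: k F => [|k IH] F /=.
  move=> cF u Uu; apply: (@continuous_comp _ _ _ F (fun M : 'M[R]_(m, n) => M i j)).
    exact: cF.
  exact: coord_continuous.
move=> [dF DF]; split=> [u Uu|v].
  by apply: differentiable_entry; exact: dF.
by apply: Ck_ext (IH _ (DF v)) => // u Uu; rewrite derive_entry //; exact: dF.
Qed.

End Ck_closure.

(** * Local diffeomorphisms of the plane *)

Section Local_diffeomorphism.
Context {R : realType}.
Implicit Types (U W : set 'rV[R]_2) (phi : 'rV[R]_2 -> 'rV[R]_2) (g : 'rV[R]_2 -> R).

Lemma sum2 (V : nmodType) (F : 'I_2 -> V) : \sum_(i < 2) F i = F 0 + F 1.
Proof.
rewrite !big_ord_recl big_ord0 addr0; congr (_ + F _).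
exact: val_inj.
Qed.

Lemma det2 (M : 'M[R]_2) : \det M = M 0 0 * M 1 1 - M 0 1 * M 1 0.
Proof.
rewrite (expand_det_row _ 0) sum2 /cofactor !det_mx11 !mxE /=.
have -> : lift 0 0 = 1 :> 'I_2 by exact: val_inj.
have -> : lift 1 0 = 0 :> 'I_2 by exact: val_inj.
by rewrite !addn0 addn1 expr0 expr1 mul1r mulN1r mulrN.
Qed.

Lemma jacobianE n m (f : 'rV[R]_n -> 'rV[R]_m) u i j : differentiable f u ->
  'J f u i j = ('D_(basis_vec R i) f u) 0 j.
Proof. by move=> df; rewrite deriveEjacobian // /basis_vec -rowE [RHS]mxE. Qed.

Lemma invmx2_row (v : 'rV[R]_2) (J : 'M[R]_2) : J \in unitmx ->
  (v *m invmx J) 0 0 = (\det J)^-1 * (v 0 0 * J 1 1 - v 0 1 * J 1 0) /\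
  (v *m invmx J) 0 1 = (\det J)^-1 * (v 0 1 * J 0 0 - v 0 0 * J 0 1).
Proof.
move=> uJ; have dJ : \det J != 0 by rewrite -unitfE -unitmxE.
have := mulmxKV uJ v; set w := v *m _ => E.
have E0 : v 0 0 = w 0 0 * J 0 0 + w 0 1 * J 1 0 by rewrite -{1}E mxE sum2.
have E1 : v 0 1 = w 0 0 * J 0 1 + w 0 1 * J 1 1 by rewrite -{1}E mxE sum2.
split; apply: (mulfI dJ); rewrite mulrA mulfV // mul1r det2 E0 E1; ring.
Qed.

(** By the chain rule a directional derivative of g o psi is h o psi, where h
    combines derivatives of g and phi and is one class less regular than g;
    hence an induction on the class. *)
Lemma Ck_comp_inverse k W phi psi g : open W -> smooth_on W phi ->
  (forall u, W u -> 'J phi u \in unitmx) -> open (phi @` W) ->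
  (forall u, W u -> psi (phi u) = u) ->
  (forall u, W u -> is_diff (phi u) psi (mulmxr (invmx ('J phi u)))) ->
  Ck k W g -> Ck k (phi @` W) (g \o psi).
Proof.
move=> oW sphi uJ oD psiK dpsi; elim: k g => [|k IH] g.
  move=> /= cg _ [u Wu <-]; apply: continuous_comp; last by rewrite psiK //; exact: cg.
  by apply: differentiable_continuous; have [] := dpsi u Wu.
move=> Cg; have [dg Dg] := Cg.
have dphi u : W u -> differentiable phi u by have [d _] := sphi 1%N; exact: d.
split=> [_ [u Wu <-]|v].
  apply: differentiable_comp; first by have [] := dpsi u Wu.
  by rewrite psiK //; exact: dg.
pose a i j u : R := ('D_(basis_vec R i) phi u) 0 j.
have Ca i j : Ck k W (a i j).
  by apply: Ck_entry => //; have [_] := sphi k.+1; exact.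
pose G i u : R := 'D_(basis_vec R i) g u.
have CG i : Ck k W (G i) by exact: Dg.
have CZ (c : R) (f : 'rV[R]_2 -> R) : Ck k W f -> Ck k W (fun u => c * f u).
  by apply: CkM => //; exact: Ck_cst.
have CB (f1 f2 : 'rV[R]_2 -> R) : Ck k W f1 -> Ck k W f2 -> Ck k W (fun u => f1 u + -1 * f2 u).
  by move=> C1 C2; apply: CkD => //; apply: CZ.
pose d u : R := a 0 0 u * a 1 1 u + -1 * (a 0 1 u * a 1 0 u).
have Cd : Ck k W d by apply: CB; apply: CkM => //; exact: Ca.
have aE i j u : W u -> 'J phi u i j = a i j u.
  by move=> Wu; apply: jacobianE; exact: dphi.
have dE u : W u -> \det ('J phi u) = d u.
  by move=> Wu; rewrite det2 !aE // /d mulN1r.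
have d0 u : W u -> d u != 0.
  by move=> Wu; rewrite -dE // -unitfE -unitmxE uJ.
(* The derivative of g in the direction v J^-1, written with Cramer's rule so as
   to be visibly of class C^k. *)
pose h u : R := (d u)^-1 *
  ((v 0 0 * a 1 1 u + -1 * (v 0 1 * a 1 0 u)) * G 0 u +
   (v 0 1 * a 0 0 u + -1 * (v 0 0 * a 0 1 u)) * G 1 u).
have Ch : Ck k W h.
  apply: CkM => //; first exact: CkV.
  by apply: CkD => //; apply: CkM => //; apply: CB; apply: CZ; exact: Ca.
apply: Ck_ext (IH h Ch) => // _ [u Wu <-].
have [dp ep] := dpsi u Wu.
rewrite /= psiK // deriveE; last first.
  by apply: differentiable_comp => //; rewrite psiK //; exact: dg.
rewrite diff_comp //; last by rewrite psiK //; exact: dg.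
rewrite ep /= psiK // -deriveE; last exact: dg.
have [w0 w1] := invmx2_row v (uJ u Wu).
rewrite derive_basis ?sum2; last exact: dg.
rewrite w0 w1 dE // !aE // -/(G 0 u) -/(G 1 u) /h /GRing.scale /=.
move: (a _ _ u) (a _ _ u) (a _ _ u) (a _ _ u) (G 0 u) (G 1 u) (d u)^-1 => *; ring.
Qed.

(** Inverse function theorem in the plane. Regularity of the inverse is
    expressed through the functions that it transports, the form needed to
    build a function of the new parameters. *)
Lemma local_diffeomorphism U phi q : open U -> smooth_on U phi ->
  (forall u, U u -> 'J phi u \in unitmx) -> U q ->
  exists W psi, [/\ [/\ open W, W q & W `<=` U], open (phi @` W),
    forall u, W u -> psi (phi u) = u &
    forall k g, Ck k W g -> Ck k (phi @` W) (g \o psi)].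
Proof.
move=> oU sphi uJ Uq.
have nU u : U u -> \forall w \near u, U w by move=> Uu; exact: open_nbhs_nbhs.
have dphi u : U u -> differentiable phi u by have [d _] := sphi 1%N; exact: d.
have bounds u (Uu : U u) : exists2 c : R, 0 < c & \forall r \near 0^'+,
    (forall x y, ball u r x -> ball u r y -> `|y - x| <= c * `|phi y - phi x|) /\
    nbhs (phi u) (phi @` ball u r).
  apply: local_inverse_bounds; last exact: uJ.
    by apply: filterS (nU u Uu) => w; exact: dphi.
  by move=> i; apply: (@Ck_continuous _ _ 1 U) => //; have [_] := sphi 2%N; exact.
have [c c0 Hc] := bounds q Uq.
have /nbhs_ballP[r0 /= r00 HU] := nU q Uq.
have : \forall r \near 0^'+, [/\ 0 < r, r <= r0 & forall x y,
    ball q r x -> ball q r y -> `|y - x| <= c * `|phi y - phi x|].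
  near=> r; split.
  - by near: r; exact: nbhs_right_gt.
  - by near: r; exact: nbhs_right_le.
  - by near: r; apply: filterS Hc => r [].
move=> /filter_ex[r [rp rr0 Hr]].
set W := ball q r.
have WU : W `<=` U by move=> x Wx; apply: HU; apply: le_ball Wx.
have oW : open W by exact: ball_open.
have nphi u : W u -> nbhs (phi u) (phi @` W).
  move=> Wu; have [cu _ Hu] := bounds u (WU _ Wu).
  have /nbhs_ballP[ru /= ru0 Hru] : nbhs u W by exact: open_nbhs_nbhs.
  have : \forall r \near 0^'+, r <= ru /\ nbhs (phi u) (phi @` ball u r).
    near=> s; split.
    - by near: s; exact: nbhs_right_le.
    - by near: s; apply: filterS Hu => s [].
  move=> /filter_ex[s [sru]]; apply: filterS => _ [x sx <-].
  by exists x => //; apply: Hru; apply: le_ball sx.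
have oD : open (phi @` W) by rewrite openE => _ [u Wu <-]; exact: nphi.
pose psi y := xget q [set x | W x /\ phi x = y].
have psiK u : W u -> psi (phi u) = u.
  move=> Wu; rewrite /psi; case: xgetP => [x _ [Wx e]|/(_ u)]; last by case.
  have := Hr _ _ Wu Wx; rewrite e subrr normr0 mulr0 normr_le0 subr_eq0.
  by move/eqP.
exists W, psi; split=> // [|k g]; first by split=> //; exact: ballxx.
apply: Ck_comp_inverse => // [k'|u Wu|u Wu].
- exact: Ck_sub (sphi k').
- exact/uJ/WU.
- apply: (is_diff_inverse (W := W) c0) => //; first exact/dphi/WU.
  + exact/uJ/WU.
  + by move=> x Wx; exact: Hr.
  + exact: nphi.
Unshelve. all: by end_near. Qed.

End Local_diffeomorphism.

(** * The pseudo scalar product and Gram matrices *)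

Section Minkowski_algebra.
Context {R : realType}.
Implicit Types (x y z w v t : 'rV[R]_4) (a b : R).

Lemma minkC x y : mink x y = mink y x.
Proof. rewrite !minkE; ring. Qed.

Lemma minkDl x y z : mink (x + y) z = mink x z + mink y z.
Proof. by rewrite /mink !mulmxDl mxE. Qed.

Lemma minkZl a x y : mink (a *: x) y = a * mink x y.
Proof. by rewrite /mink -!scalemxAl mxE. Qed.

Lemma minkNl x y : mink (- x) y = - mink x y.
Proof. by rewrite -scaleN1r minkZl mulN1r. Qed.

Lemma mink0l x : mink 0 x = 0.
Proof. by rewrite /mink !mul0mx mxE. Qed.

Lemma minkDr x y z : mink z (x + y) = mink z x + mink z y.
Proof. by rewrite minkC minkDl !(minkC _ z). Qed.

Lemma minkZr a x y : mink x (a *: y) = a * mink x y.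
Proof. by rewrite minkC minkZl minkC. Qed.

Lemma minkNr x y : mink x (- y) = - mink x y.
Proof. by rewrite minkC minkNl minkC. Qed.

(** Products of this shape are Gram matrices, which translates statements on
    Jacobian matrices into pseudo scalar products of partial derivatives. *)
Lemma gramE m n (M : 'M[R]_(m, 4)) (N : 'M[R]_(n, 4)) i j :
  (M *m eta R *m N^T) i j = mink (row i M) (row j N).
Proof.
rewrite /mink -row_mul !mxE; apply: eq_bigr => k _.
by rewrite ![row _ _ _ _]mxE [N^T _ _]mxE [(row _ _)^T _ _]mxE [row _ _ _ _]mxE.
Qed.

Lemma eta_sqr : eta R *m eta R = 1%:M.
Proof.
apply/matrixP => i j; rewrite /eta mul_mx_diag !mxE.
have [->|ij] := eqVneq i j; last by rewrite mulr0n mul0r.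
by rewrite mulr1n; case: ifP; rewrite ?mulrNN mulr1.
Qed.

(** Natural number indices make the rows and columns left after each expansion
    computable. *)
Definition expanded_det4 (m : nat -> nat -> R) : R :=
  let d2 i j := m 2 i * m 3 j - m 2 j * m 3 i in
  let d3 i j k := m 1 i * d2 j k - m 1 j * d2 i k + m 1 k * d2 i j in
  m 0 0 * d3 1 2 3 - m 0 1 * d3 0 2 3 + m 0 2 * d3 0 1 3 - m 0 3 * d3 0 1 2.

Lemma det_expanded4 (M : 'M[R]_4) (m : nat -> nat -> R) :
  (forall i j, M i j = m i j) -> \det M = expanded_det4 m.
Proof.
move=> Mm; rewrite (expand_det_row _ (0 : 'I_4)) !big_ord_recl big_ord0 addr0.
rewrite /cofactor !(expand_det_row _ (0 : 'I_3)) !big_ord_recl !big_ord0 !addr0.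
rewrite /cofactor !det2 !mxE !Mm /= /bump /=.
rewrite /expanded_det4 !expr0 ?expr1 ?expr2.
ring.
Qed.

End Minkowski_algebra.

(** * Determinants and the wedge product *)

Section Wedge.
Context {R : realType}.
Implicit Types (x y z w v t : 'rV[R]_4) (a b : R).

(** Entries indexed by natural numbers, so that explicit 4 x 4 computations
    reduce by simplification. *)
Definition coord x (j : nat) : R := x 0 (inord j).

Lemma coordE x : [/\ coord x 0 = x 0 0, coord x 1 = x 0 1,
  coord x 2 = x 0 2%:R & coord x 3 = x 0 3%:R].
Proof. by split; congr (x 0 _); apply: val_inj; rewrite /= inordK. Qed.

Lemma row4P x y : (forall j, (j < 4)%N -> coord x j = coord y j) -> x = y.
Proof.
by move=> xy; apply/rowP => i; have := xy i (ltn_ord i); rewrite /coord inord_val.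
Qed.

Lemma col_mx4E x y z w i j :
  (col_mx x (col_mx y (col_mx z w)) : 'M[R]_(1 + (1 + (1 + 1)), 4)) i j =
  (nth 0 [:: x; y; z; w] i) 0 j.
Proof.
rewrite mxE; case: splitP => [k ->|k ->]; first by rewrite ord1.
rewrite mxE; case: splitP => [l ->|l ->]; first by rewrite !ord1.
by rewrite mxE; case: splitP => [p ->|p ->]; rewrite !ord1.
Qed.

Lemma det4E x y z w :
  det4 x y z w = expanded_det4 (fun i => coord (nth 0 [:: x; y; z; w] i)).
Proof. by apply: det_expanded4 => i j; rewrite /coord inord_val; exact: col_mx4E. Qed.

Lemma mink_coord x y : mink x y = - (coord x 0 * coord y 0) + coord x 1 * coord y 1
  + coord x 2 * coord y 2 + coord x 3 * coord y 3.
Proof. by rewrite minkE; have [<- <- <- <-] := coordE x; have [<- <- <- <-] := coordE y. Qed.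

Lemma coord_basis (i j : nat) : (i < 4)%N -> (j < 4)%N ->
  coord (basis_vec R (inord i)) j = (i == j)%:R.
Proof.
move=> i4 j4; rewrite /coord /basis_vec mxE eqxx /= eq_sym; congr (_ %:R).
by rewrite -val_eqE /= !inordK.
Qed.

Lemma coord_wedge x y z (j : nat) : (j < 4)%N -> coord (wedge x y z) j =
  (if j == 0%N then -1 else 1) * det4 (basis_vec R (inord j)) x y z.
Proof.
move=> j4; rewrite /coord mxE /eta mxE eqxx mulr1n mxE.
by rewrite -val_eqE /= inordK.
Qed.

(** The square of a wedge product is minus a Gram determinant, as the
    determinant of eta is -1. *)
Lemma mink_wedge x y z : mink (wedge x y z) (wedge x y z) =
  - (mink x x * (mink y y * mink z z - mink y z * mink y z)
     - mink x y * (mink x y * mink z z - mink y z * mink x z)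
     + mink x z * (mink x y * mink y z - mink y y * mink x z)).
Proof.
rewrite !mink_coord !coord_wedge // !det4E /expanded_det4 /= !coord_basis //=.
rewrite ?mul0r ?mul1r ?subr0 ?sub0r ?add0r ?addr0.
move: (coord x 0) (coord x 1) (coord x 2) (coord x 3).
move: (coord y 0) (coord y 1) (coord y 2) (coord y 3).
move: (coord z 0) (coord z 1) (coord z 2) (coord z 3).
by move=> z0 z1 z2 z3 y0 y1 y2 y3 x0 x1 x2 x3; ring.
Qed.

Lemma cauchy_schwarz3 (x1 x2 x3 t1 t2 t3 : R) :
  (x1 * t1 + x2 * t2 + x3 * t3) ^+ 2 <=
  (x1 ^+ 2 + x2 ^+ 2 + x3 ^+ 2) * (t1 ^+ 2 + t2 ^+ 2 + t3 ^+ 2).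
Proof.
rewrite -subr_ge0 (_ : _ - _ = (x1 * t2 - x2 * t1) ^+ 2 +
  (x1 * t3 - x3 * t1) ^+ 2 + (x2 * t3 - x3 * t2) ^+ 2); last by ring.
by rewrite !addr_ge0 ?sqr_ge0.
Qed.

(** If x were not future directed, Cauchy-Schwarz in the spatial coordinates
    would give <x, t> >= 0: the spatial part of t is shorter than its time
    coordinate. *)
Lemma future_null t x : mink t t = -1 -> 0 < coord t 0 ->
  mink x x = 0 -> mink x t < 0 -> 0 < coord x 0.
Proof.
rewrite !mink_coord.
move: (coord x 0) (coord x 1) (coord x 2) (coord x 3).
move: (coord t 0) (coord t 1) (coord t 2) (coord t 3).
move=> t0 t1 t2 t3 x0 x1 x2 x3 tt t0p xx xt; rewrite ltNge; apply/negP => x0n.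
have cs := cauchy_schwarz3 x1 x2 x3 t1 t2 t3.
have E1 : t1 ^+ 2 + t2 ^+ 2 + t3 ^+ 2 = t0 ^+ 2 - 1 by rewrite !expr2; lra.
have E2 : x1 ^+ 2 + x2 ^+ 2 + x3 ^+ 2 = x0 ^+ 2 by rewrite !expr2; lra.
move: cs; rewrite E1 E2; set p := x1 * t1 + x2 * t2 + x3 * t3 => cs.
have pn : p < x0 * t0 by rewrite /p; lra.
have xt0 : x0 * t0 <= 0 by rewrite mulr_le0_ge0 // ltW.
have : (x0 * t0) ^+ 2 < p ^+ 2 by rewrite !expr2; nra.
rewrite exprMn => h; have := sqr_ge0 x0; nra.
Qed.

Lemma det4_mulmx (A : 'M[R]_4) x y z w :
  det4 (x *m A) (y *m A) (z *m A) (w *m A) = det4 x y z w * \det A.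
Proof. by rewrite /det4 -!mul_col_mx det_mulmx. Qed.

(** A vector orthogonal to a basis vanishes, the pseudo scalar product being
    nondegenerate. *)
Lemma det4_orthogonal x y z w v : det4 x y z w != 0 ->
  mink v x = 0 -> mink v y = 0 -> mink v z = 0 -> mink v w = 0 -> v = 0.
Proof.
rewrite /det4; set M := (col_mx _ _ : 'M[R]_(1 + (1 + (1 + 1)))) => dM vx vy vz vw.
have uM : M \in unitmx by rewrite unitmxE unitfE.
have z1 u : mink v u = 0 -> u *m (eta R *m v^T) = 0.
  move=> vu; apply/matrixP => i j; rewrite !ord1 mulmxA [RHS]mxE -vu minkC.
  by [].
have : M *m (eta R *m v^T) = 0.
  by rewrite /M !mul_col_mx !z1 // !col_mx0.
move/(congr1 (mulmx (invmx M))); rewrite mulKmx // mulmx0.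
move/(congr1 (mulmx (eta R))); rewrite mulmxA eta_sqr mul1mx mulmx0.
by move/(congr1 trmx); rewrite trmxK trmx0.
Qed.

Lemma det4_repeat x y z :
  [/\ det4 x x y z = 0, det4 y x y z = 0 & det4 z x y z = 0].
Proof. by split; rewrite det4E /expanded_det4 /=; ring. Qed.

End Wedge.

Lemma coordD (R : realType) (x y : 'rV[R]_4) j : coord (x + y) j = coord x j + coord y j.
Proof. by rewrite /coord mxE. Qed.

Lemma coordZ (R : realType) (a : R) (x : 'rV[R]_4) j : coord (a *: x) j = a * coord x j.
Proof. by rewrite /coord mxE. Qed.

(** * The shape operator and the two fundamental forms *)

Section Differentiability.
Context {R : realType} {V : normedModType R}.

(** The Leibniz formula is a polynomial in the entries. *)
Lemma differentiable_det n (F : V -> 'M[R]_n) u :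
  differentiable F u -> differentiable (fun w => \det (F w)) u.
Proof.
move=> dF.
have dprod (I : Type) (r : seq I) (f : I -> V -> R) :
    (forall i, differentiable (f i) u) -> differentiable (\prod_(i <- r) f i) u.
  move=> df; elim/big_ind : _ => //.
  by move=> *; exact: differentiableM.
have -> : (fun w => \det (F w)) =
    \sum_(s : 'S_n) ((-1) ^+ s \*: \prod_(i <- index_enum 'I_n) (fun w => F w i (s i))).
  by apply/funext => w; rewrite fct_sumE; apply: eq_bigr => s _; rewrite fct_prodE.
elim/big_ind : _ => //.
- by move=> *; exact: differentiableD.
- by move=> s _; apply: differentiableZ; apply: dprod => i; exact: differentiable_entry.
Qed.

Implicit Types F G : V -> 'rV[R]_4.

Let mink_sum (x y : 'rV[R]_4) : mink x y = \sum_(k < 4) (x *m eta R) 0 k * y 0 k.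
Proof. by rewrite /mink mxE; apply: eq_bigr => k _; rewrite [y^T _ _]mxE. Qed.

Lemma is_derive_mink F G u v : differentiable F u -> differentiable G u ->
  is_derive u v (fun w => mink (F w) (G w))
    (mink (F u) ('D_v G u) + mink (G u) ('D_v F u)).
Proof.
move=> dF dG.
have -> : (fun w => mink (F w) (G w)) =
   \sum_(k < 4) ((fun w => (F w *m eta R + 0) 0 k) * (fun w => G w 0 k)).
  apply/funext => w; rewrite mink_sum fct_sumE; apply: eq_bigr => k _.
  by rewrite -[RHS]/((F w *m eta R + 0) 0 k * G w 0 k) addr0.
have dFe : differentiable (fun w => F w *m eta R + 0) u by exact: differentiable_affine.
have dk k : is_derive u v ((fun w => (F w *m eta R + 0) 0 k) * (fun w => G w 0 k))
    ((F u *m eta R + 0) 0 k *: 'D_v G u 0 k + G u 0 k *: ('D_v F u *m eta R) 0 k).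
  apply: is_deriveM.
    rewrite -(derive_affine _ 0) // derive_entry //.
    by apply: derivableP; apply: diff_derivable; exact: differentiable_entry.
  rewrite derive_entry //.
  by apply: derivableP; apply: diff_derivable; exact: differentiable_entry.
apply: is_derive_eq (is_derive_sum dk) _.
rewrite (minkC (G u)) !mink_sum -big_split /=; apply: eq_bigr => k _.
by rewrite addr0 /GRing.scale /= [G u _ _ * _]mulrC.
Qed.

Lemma differentiable_mink F G u : differentiable F u -> differentiable G u ->
  differentiable (fun w => mink (F w) (G w)) u.
Proof.
move=> dF dG.
have -> : (fun w => mink (F w) (G w)) =
   \sum_(k < 4) ((fun w => (F w *m eta R + 0) 0 k) * (fun w => G w 0 k)).
  apply/funext => w; rewrite mink_sum fct_sumE; apply: eq_bigr => k _.
  by rewrite -[RHS]/((F w *m eta R + 0) 0 k * G w 0 k) addr0.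
apply: differentiable_sum => k; apply: differentiableM; last exact: differentiable_entry.
by apply: (@differentiable_entry _ _ _ _ (fun w => F w *m eta R + 0)); exact: differentiable_affine.
Qed.

Lemma differentiable_wedge (F G H : V -> 'rV[R]_4) u :
  differentiable F u -> differentiable G u -> differentiable H u ->
  differentiable (fun w => wedge (F w) (G w) (H w)) u.
Proof.
move=> dF dG dH; apply: differentiable_mx => i j.
have -> : (fun w => wedge (F w) (G w) (H w) i j) =
  (eta R j j) \*: (fun w => det4 (basis_vec R j) (F w) (G w) (H w)).
  by apply/funext => w; rewrite mxE.
apply: differentiableZ; apply: differentiable_det; apply: differentiable_mx => k l.
rewrite (_ : (fun _ => _) =
    fun w => (nth 0 [:: basis_vec R j; F w; G w; H w] k) 0 l); last first.
  by apply/funext => w; exact: col_mx4E.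
case: k => -[|[|[|[|k]]]] //= _; exact: differentiable_entry.
Qed.

End Differentiability.

Section Shape_operator.
Context {R : realType}.
Implicit Types (X n : 'rV[R]_2 -> 'rV[R]_4).

(** When the Gram matrix G of the rows of J is invertible, the row space of J
    and its orthogonal are complementary, and M J^* G^-1, with J^* = eta J^T,
    gives the coefficients of the orthogonal projection of the rows of M. *)
Lemma orthogonal_proj_coef m (J : 'M[R]_(m, 4)) l (M : 'M[R]_(l, 4)) :
  J *m eta R *m J^T \in unitmx ->
  M *m proj_mx <<J>>%MS (kermx (eta R *m J^T)) *m pinvmx J =
  M *m eta R *m J^T *m invmx (J *m eta R *m J^T).
Proof.
move=> uG; pose K := kermx (eta R *m J^T).
have KP p (N : 'M[R]_(p, 4)) : (N <= K)%MS = (N *m eta R *m J^T == 0).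
  by rewrite -mulmxA; apply/sub_kermxP/eqP.
have cap : (<<J>> :&: K)%MS = 0.
  apply/eqP/rowV0P => x; rewrite sub_capmx genmxE => /andP[/submxP[y ->]].
  rewrite KP -(mulmxA y) -(mulmxA y) => /eqP /(congr1 (mulmx^~ (invmx (J *m eta R *m J^T)))).
  by rewrite mul0mx mulmxK // => ->; rewrite mul0mx.
have MS : (M <= <<J>> + K)%MS.
  pose T := M *m eta R *m J^T *m invmx (J *m eta R *m J^T).
  rewrite -(subrK (T *m J) M) addrC addmx_sub_adds //; first by rewrite genmxE submxMl.
  by rewrite KP !mulmxBl subr_eq0 -(mulmxA T) -(mulmxA T) mulmxKV.
have E := add_proj_mx cap MS.
have QK : M *m proj_mx K <<J>>%MS *m eta R *m J^T = 0.
  by apply/eqP; rewrite -KP proj_mx_sub.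
have PJ : (M *m proj_mx <<J>>%MS K <= J)%MS by rewrite -(genmxE J) proj_mx_sub.
rewrite -[in RHS]E !mulmxDl QK mul0mx addr0.
rewrite -[in RHS](mulmxKpV PJ) -(mulmxA _ J) -(mulmxA _ (J *m _)).
by rewrite mulmxK.
Qed.

(** Weingarten formula: the first factor consists of the products <D_i n,
    X_j>, the second is the inverse of the first fundamental form. *)
Lemma shape_opE X n u :
  'J X u *m eta R *m ('J X u)^T \in unitmx ->
  shape_op X n u = - ('J n u *m eta R *m ('J X u)^T *m
                      invmx ('J X u *m eta R *m ('J X u)^T)).
Proof. by move=> uG; rewrite /shape_op mulNmx orthogonal_proj_coef. Qed.

(** A vector v in the kernel of the Gram matrix gives the tangent vector v J
    of zero square, which has to vanish. *)
Lemma first_form_unit (J : 'M[R]_(2, 4)) : row_free J ->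
  (forall x : 'rV[R]_4, (x <= J)%MS -> x != 0 -> spacelike x) ->
  J *m eta R *m J^T \in unitmx.
Proof.
move=> fJ sJ; rewrite -row_free_unit; apply/inj_row_free => v vG.
apply/eqP; apply: contraT => v0.
have vJ : v *m J != 0 by apply: contra v0 => /eqP vJ; apply/eqP/(row_free_inj fJ); rewrite mul0mx.
have [_] := sJ _ (submxMl v J) vJ.
by rewrite /mink trmx_mul !mulmxA -(mulmxA v J) -(mulmxA v) vG mul0mx mxE ltxx.
Qed.

End Shape_operator.

(** * The normal frame *)

(** Since t is a unit timelike vector orthogonal to y and z, the square of the
    wedge product is the Gram determinant of y and z, positive as they span a
    spacelike plane. *)
Lemma wedge_spacelike (R : realType) (t y z : 'rV[R]_4) :
  mink t t = -1 -> mink t y = 0 -> mink t z = 0 ->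
  (forall v : 'rV[R]_2, v != 0 -> let p := v 0 0 *: y + v 0 1 *: z in 0 < mink p p) ->
  0 < mink (wedge t y z) (wedge t y z).
Proof.
move=> tt ty tz pos; rewrite mink_wedge tt ty tz.
have q (a b : R) : (a != 0) || (b != 0) ->
    0 < a * (a * mink y y) + b * (b * mink z z) + 2 * (a * b) * mink y z.
  move=> ab; pose v : 'rV[R]_2 := \row_(k < 2) (if k == 0 then a else b).
  have v0 : v 0 0 = a by rewrite mxE.
  have v1 : v 0 1 = b by rewrite mxE.
  have vn : v != 0.
    by apply: contraTneq ab => v_0; rewrite -v0 -v1 v_0 !mxE eqxx.
  have := pos v vn; rewrite v0 v1 /= minkDl !minkDr !minkZl !minkZr (minkC z y).
  by congr (0 < _); ring.
have zz : 0 < mink z z.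
  by have := q 0 1; rewrite oner_neq0 orbT => /(_ isT); rewrite !mul1r !mul0r mulr0 mul0r addr0 add0r.
(* The vector <z, z> y - <y, z> z is a multiple of the part of y orthogonal to
   z; its square is <z, z> times the Gram determinant. *)
have := q (mink z z) (- mink y z); rewrite gt_eqF //= => /(_ isT).
move: zz; move: (mink z z) (mink y y) (mink y z) => c a b c0 H.
rewrite (_ : - _ = a * c - b * b); last by ring.
by rewrite -(pmulr_rgt0 _ c0); move: H; congr (0 < _); ring.
Qed.

(** The products of the wedge product with t, y and z are determinants with a
    repeated row. *)
Lemma unit_conormal (R : realType) (t y z : 'rV[R]_4) :
  let w := wedge t y z in let s := (mink_norm w)^-1 *: w in 0 < mink w w ->
  [/\ mink s y = 0, mink s z = 0, mink s s = 1, mink s t = 0 & 0 < det4 s t y z].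
Proof.
move=> w s ww; have wE v : mink v w = det4 v t y z.
  exact: (iffLR (wedgeP _ _ _ w) erefl v).
have nw : 0 < mink_norm w by rewrite sqrtr_gt0 normr_gt0 gt_eqF.
have nw2 : mink_norm w ^+ 2 = mink w w by rewrite sqr_sqrtr // gtr0_norm.
have [t0 y0 z0] := det4_repeat t y z.
split.
- by rewrite minkZl minkC wE y0 mulr0.
- by rewrite minkZl minkC wE z0 mulr0.
- by rewrite minkZl minkZr -nw2 mulrA -expr2 -exprMn mulVf ?expr1n // gt_eqF.
- by rewrite minkZl minkC wE t0 mulr0.
- by rewrite -wE minkZl mulr_gt0 // invr_gt0.
Qed.

Lemma orthogonal_combination (R : realType) (x y z : 'rV[R]_4) (a b : R) :
  mink x y = 0 -> mink x z = 0 -> mink x (a *: y + b *: z) = 0.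
Proof. by move=> xy xz; rewrite minkDr !minkZr xy xz !mulr0 addr0. Qed.

(** The difference of the two sides is orthogonal to s, t, y and z, a basis. *)
Lemma orthonormal_decomposition (R : realType) (s t y z x : 'rV[R]_4) :
  det4 s t y z != 0 -> mink t t = -1 -> mink s s = 1 -> mink s t = 0 ->
  mink t y = 0 -> mink t z = 0 -> mink s y = 0 -> mink s z = 0 ->
  mink x y = 0 -> mink x z = 0 -> x = - mink x t *: t + mink x s *: s.
Proof.
move=> d0 tt ss st ty tz sy sz xy xz; apply/eqP; rewrite -subr_eq0; apply/eqP.
apply: (det4_orthogonal d0);
  rewrite minkDl minkNl minkDl !minkZl ?xy ?xz ?ty ?tz ?sy ?sz ?tt ?ss ?st.
- by rewrite (minkC t) st; ring.
- by ring.
- by ring.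
- by ring.
Qed.

Section Normal_frame.
Context {R : realType}.
Variables (U : set 'rV[R]_2) (X nT : 'rV[R]_2 -> 'rV[R]_4).
Hypothesis hX : spacelike_surface U X.
Hypothesis hn : future_timelike_normal U X nT.

Let e0 := basis_vec R (0 : 'I_2).
Let e1 := basis_vec R (1 : 'I_2).
Let nS := spacelike_normal X nT.

Lemma surface_open : open U. Proof. by case: hX. Qed.

Lemma near_surface u : U u -> \forall w \near u, U w.
Proof. by move=> Uu; apply: open_nbhs_nbhs; split => //; exact: surface_open. Qed.

Lemma surface_differentiable u : U u -> differentiable X u.
Proof. by case: hX => _ [sX _ _ _] _; have [d _] := sX 1%N; exact: d. Qed.

Lemma surface_derive_differentiable u v : U u -> differentiable ('D_v X) u.
Proof. by case: hX => _ [sX _ _ _] _; have [_ /(_ v)[d _]] := sX 2%N; exact: d. Qed.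

Lemma timelike_differentiable u : U u -> differentiable nT u.
Proof. by case: hn => sn _; have [d _] := sn 1%N; exact: d. Qed.

Lemma first_fundamental_form_unit u : U u ->
  'J X u *m eta R *m ('J X u)^T \in unitmx.
Proof.
case: hX => _ [_ fJ _ _] sp Uu; apply: first_form_unit; first exact: fJ.
exact: sp.
Qed.

Lemma row_jacobian m (F : 'rV[R]_2 -> 'rV[R]_m) u i : differentiable F u ->
  row i ('J F u) = 'D_(basis_vec R i) F u.
Proof. by move=> dF; rewrite deriveEjacobian // rowE. Qed.

Lemma normal_toP u x : U u ->
  normal_to X u x <-> forall v, mink x ('D_v X u) = 0.
Proof.
move=> Uu; have dX := surface_differentiable Uu; split=> [nx v|nx y /submxP[v ->]].
  by apply: nx; rewrite deriveEjacobian // submxMl.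
by rewrite -deriveEjacobian.
Qed.

Lemma timelike_normalP u : U u ->
  [/\ forall v, mink (nT u) ('D_v X u) = 0, mink (nT u) (nT u) = -1 &
      0 < coord (nT u) 0].
Proof.
move=> Uu; have [_ /(_ u Uu)[nx tt t0]] := hn; split=> //.
  by apply/normal_toP.
move: t0; rewrite mink_coord.
have E j : (j < 4)%N -> coord (basis_vec R (0 : 'I_4)) j = (0 == j)%:R.
  move=> j4; rewrite -(coord_basis _ j4) //; congr coord; congr basis_vec.
  by apply: val_inj; rewrite /= inordK.
by rewrite !E //= mulr1 !mulr0 !addr0 oppr_lt0.
Qed.

Lemma spacelike_tangent u v : U u -> v != 0 -> 0 < mink ('D_v X u) ('D_v X u).
Proof.
move=> Uu v0; have dX := surface_differentiable Uu.
case: hX => _ [_ fJ _ _] sp; rewrite deriveEjacobian //.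
have [] // := sp u Uu (v *m 'J X u) (submxMl _ _).
by apply: contra v0 => /eqP vJ; apply/eqP/(row_free_inj (fJ u Uu)); rewrite mul0mx.
Qed.

Lemma conormal_spacelike u : U u ->
  0 < mink (wedge (nT u) ('D_e0 X u) ('D_e1 X u)) (wedge (nT u) ('D_e0 X u) ('D_e1 X u)).
Proof.
move=> Uu; have [nx tt _] := timelike_normalP Uu.
apply: wedge_spacelike; rewrite ?nx ?tt // => v v0.
rewrite -(sum2 (fun k => v 0 k *: 'D_(basis_vec R k) X u)).
rewrite -derive_basis; first exact: spacelike_tangent.
exact: surface_differentiable.
Qed.

Lemma spacelike_normalP u : U u ->
  [/\ forall v, mink (nS u) ('D_v X u) = 0, mink (nS u) (nS u) = 1,
      mink (nS u) (nT u) = 0 & 0 < det4 (nS u) (nT u) ('D_e0 X u) ('D_e1 X u)].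
Proof.
move=> Uu; have [y0 z0 ss st d0] := unit_conormal (conormal_spacelike Uu).
split; [move=> v | exact: ss | exact: st | exact: d0].
have -> := derive_basis v (surface_differentiable Uu).
have -> := sum2 (fun k => v 0 k *: 'D_(basis_vec R k) X u).
exact: (orthogonal_combination _ _ y0 z0).
Qed.

Lemma normal_decomposition u x : U u -> (forall v, mink x ('D_v X u) = 0) ->
  x = - mink x (nT u) *: nT u + mink x (nS u) *: nS u.
Proof.
move=> Uu nx; have [tX tt _] := timelike_normalP Uu.
have [sX ss st d0] := spacelike_normalP Uu.
exact: (orthonormal_decomposition (lt0r_neq0 d0) tt ss st (tX e0) (tX e1)
  (sX e0) (sX e1) (nx e0) (nx e1)).
Qed.

(** The norm of the wedge product is differentiable because the square under
    the root stays positive on U. *)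
Lemma spacelike_normal_differentiable u : U u -> differentiable nS u.
Proof.
move=> Uu; pose w v := wedge (nT v) ('D_e0 X v) ('D_e1 X v).
have dw : differentiable w u.
  apply: differentiable_wedge; first exact: timelike_differentiable.
    exact: surface_derive_differentiable.
  exact: surface_derive_differentiable.
have w0 v : U v -> 0 < mink (w v) (w v) by move=> Uv; exact: conormal_spacelike.
have dnorm : differentiable (fun v => mink_norm (w v)) u.
  apply: (@near_eq_differentiable _ _ _ (fun v => Num.sqrt (mink (w v) (w v)))).
    by apply: filterS (near_surface Uu) => v Uv; rewrite /mink_norm gtr0_norm ?w0.
  apply: (@differentiable_comp _ _ _ _ (fun v => mink (w v) (w v)) Num.sqrt).
    exact: differentiable_mink.
  apply/derivable1_diffP.
  by have [] := is_derive1_sqrt (w0 u Uu).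
apply: differentiable_mx => i j.
rewrite (_ : (fun _ => _) = (fun v => (mink_norm (w v))^-1) * (fun v => w v i j)); last first.
  by apply/funext => v; rewrite /nS /spacelike_normal mxE.
apply: differentiableM; last exact: differentiable_entry.
apply: differentiableV => //.
by rewrite gt_eqF // sqrtr_gt0 normr_gt0 gt_eqF // w0.
Qed.

Lemma null_sum_normalP u : U u -> let n := nT u + nS u in
  [/\ forall v, mink n ('D_v X u) = 0, mink n n = 0, mink n (nT u) = -1 &
      0 < coord n 0].
Proof.
move=> Uu n; have [tX tt t0] := timelike_normalP Uu.
have [sX ss st _] := spacelike_normalP Uu.
have nn : mink n n = 0 by rewrite minkDl !minkDr tt ss st minkC st; ring.
have nt : mink n (nT u) = -1 by rewrite minkDl tt st addr0.
split; [| exact: nn | exact: nt |].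
  by move=> v; rewrite minkDl tX sX addr0.
by apply: (future_null tt t0 nn); rewrite nt ltrN10.
Qed.

End Normal_frame.

(** * Graphs over the spacelike coordinates of a null hyperplane *)

Lemma derive_comp_basis (R : realType) (phi : 'rV[R]_2 -> 'rV[R]_2)
    (h : 'rV[R]_2 -> R) u v :
  differentiable phi u -> differentiable h (phi u) ->
  'D_v (h \o phi) u = \sum_k ('D_v phi u) 0 k * 'D_(basis_vec R k) h (phi u).
Proof.
move=> dp dh; rewrite deriveE; last exact: differentiable_comp.
by rewrite diff_comp //= -!deriveE // derive_basis.
Qed.

Lemma congruence_entry (R : realType) (c : R) (P H : 'M[R]_2) i j :
  (- (c *: (P *m H *m P^T))) i j =
  \sum_k P j k * - (c * \sum_l P i l * H l k).
Proof.
rewrite !mxE mulr_sumr -sumrN; apply: eq_bigr => k _.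
by rewrite !mxE mulrN; congr (- _); rewrite mulrA mulrC.
Qed.

Lemma congruence_over_gram (R : realType) (c : R) (P H : 'M[R]_2) :
  P \in unitmx ->
  (c *: (P *m H *m P^T)) *m invmx (P *m P^T) = c *: (P *m H *m invmx P).
Proof.
move=> uP; have uPT : P^T \in unitmx by rewrite unitmx_tr.
rewrite -scalemxAl; congr (_ *: _).
have -> : P *m H *m P^T = P *m H *m invmx P *m (P *m P^T).
  by rewrite !mulmxA mulmxKV.
by rewrite mulmxK // unitmx_mul uP.
Qed.

(** The pseudo scalar product with the null vector (1, 1, 0, 0). *)
Definition null_part (R : realType) (x : 'rV[R]_4) : R := coord x 1 - coord x 0.

(** Subtracting the first column from the second turns the rows of l, y and z
    into (1, 0, 0, 0), (y_0, 0, y_2, y_3) and (z_0, 0, z_2, z_3). *)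
Lemma det4_null (R : realType) (l x y z : 'rV[R]_4) :
  [/\ coord l 0 = 1, coord l 1 = 1, coord l 2 = 0 & coord l 3 = 0] ->
  coord y 1 = coord y 0 -> coord z 1 = coord z 0 ->
  det4 l x y z =
  null_part x * (coord y 2 * coord z 3 - coord y 3 * coord z 2).
Proof.
move=> [l0 l1 l2 l3] y1 z1.
by rewrite det4E /expanded_det4 /= l0 l1 l2 l3 y1 z1 /null_part; ring.
Qed.

Section Graph.
Context {R : realType}.
Variables (X : 'rV[R]_2 -> 'rV[R]_4) (A : 'M[R]_4) (b : 'rV[R]_4).
Variables (W D : set 'rV[R]_2) (phi : 'rV[R]_2 -> 'rV[R]_2) (f : 'rV[R]_2 -> R).
Hypothesis lA : lorentz A.
Hypothesis oW : open W.
Hypothesis dX : forall u, W u -> differentiable X u.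
Hypothesis dphi : forall u, W u -> differentiable phi u.
Hypothesis uphi : forall u, W u -> 'J phi u \in unitmx.
Hypothesis phiD : forall u, W u -> D (phi u).
Hypothesis f2 : Ck 2 D f.
Hypothesis Xf : forall u, W u -> X u *m A + b = graph_surface f (phi u).

Let e (k : 'I_2) := basis_vec R k.
Let grad (k : 'I_2) (v : 'rV[R]_2) : R := 'D_(e k) f v.
Let tail (x : 'rV[R]_4) (k : 'I_2) : R := coord x k.+2.

Let df v : D v -> differentiable f v. Proof. by case: f2 => d _; exact: d. Qed.

Let dgrad k v : D v -> differentiable (grad k) v.
Proof. by case: f2 => _ /(_ (e k))[d _]; exact: d. Qed.

Let near_W u : W u -> \forall w \near u, W w.
Proof. by move=> Wu; exact: open_nbhs_nbhs. Qed.

Lemma coord_derive (F : 'rV[R]_2 -> 'rV[R]_4) u v j : differentiable F u ->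
  coord ('D_v F u) j = 'D_v (fun w => coord (F w) j) u.
Proof. by move=> dF; rewrite /coord derive_entry. Qed.

(** Coordinates of a tangent vector of the graph: the height function
    contributes its derivative twice, the last two coordinates are those of
    the image parameters. *)
Lemma graph_tangent u v : W u -> let y := 'D_v X u *m A in
  [/\ coord y 0 = \sum_k ('D_v phi u) 0 k * grad k (phi u),
      coord y 1 = coord y 0 & forall k, tail y k = ('D_v phi u) 0 k].
Proof.
move=> Wu y; have dY : differentiable (fun w => X w *m A + b) u.
  by apply: differentiable_affine; exact: dX.
have yE j : coord y j = 'D_v (fun w => coord (graph_surface f (phi w)) j) u.
  rewrite /y -(derive_affine A b v (dX Wu)) coord_derive //.
  by apply: near_eq_derive; apply: filterS (near_W Wu) => w Ww; rewrite Xf.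
have gE v' : [/\ coord (graph_surface f v') 0 = f v', coord (graph_surface f v') 1 = f v',
    coord (graph_surface f v') 2 = v' 0 0 & coord (graph_surface f v') 3 = v' 0 1].
  by split; rewrite /coord mxE inordK.
have y0 : coord y 0 = 'D_v (f \o phi) u.
  by rewrite yE; congr ('D_v _ u); apply/funext => w; have [-> _ _ _] := gE (phi w).
split.
- by rewrite y0 derive_comp_basis //; [exact: dphi | exact/df/phiD].
- by rewrite y0 yE; congr ('D_v _ u); apply/funext => w; have [_ -> _ _] := gE (phi w).
- move=> k; rewrite /tail yE derive_entry; last exact: dphi.
  congr ('D_v _ u); apply/funext => w; have [_ _ g2 g3] := gE (phi w).
  by case: k => -[|[|//]] ltk /=; rewrite ?g2 ?g3; congr (phi w 0 _); exact: val_inj.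
Qed.

Lemma mink_graph_tangent u v x : W u -> let z := x *m A in
  mink x ('D_v X u) =
  \sum_k ('D_v phi u) 0 k * (tail z k + null_part z * grad k (phi u)).
Proof.
move=> Wu z; have [y0 y1 yt] := graph_tangent v Wu.
rewrite -(lorentzP lA) mink_coord y1 y0 !sum2 -/z.
have := yt 0; rewrite /tail /= => ->; have := yt 1; rewrite /tail /= => ->.
by rewrite /null_part; ring.
Qed.


Let JE u (i j : 'I_2) : W u -> 'J phi u i j = ('D_(e i) phi u) 0 j.
Proof. by move=> Wu; exact: jacobianE (dphi Wu). Qed.

(** Tangent vectors of the null hyperplane have equal first two coordinates,
    whose contributions cancel: the induced metric is Euclidean in the
    parameters phi. *)
Lemma first_form_graph u : W u ->
  'J X u *m eta R *m ('J X u)^T = 'J phi u *m ('J phi u)^T.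
Proof.
move=> Wu; apply/matrixP => i j; rewrite gramE !row_jacobian; [|exact: dX..].
rewrite mink_graph_tangent // [RHS]mxE; apply: eq_bigr => k _.
have [_ y1 yt] := graph_tangent (e i) Wu.
rewrite yt /null_part y1 subrr mul0r addr0 [(_^T) k j]mxE.
by rewrite (JE i k Wu) (JE j k Wu); exact: mulrC.
Qed.

(** Normality determines the last two coordinates from the null part and the
    gradient of f, by invertibility of the Jacobian matrix of phi. *)
Lemma normal_graph u x : W u -> (forall v, mink x ('D_v X u) = 0) ->
  forall k, tail (x *m A) k = - (null_part (x *m A) * grad k (phi u)).
Proof.
(* In this parameter direction phi has the k-th basis vector as derivative. *)
move=> Wu nx k; have := nx (e k *m invmx ('J phi u)).
rewrite mink_graph_tangent // deriveEjacobian; last exact: dphi.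
rewrite mulmxKV ?uphi // (bigD1 k) //= big1 => [|l lk]; last first.
  by rewrite mxE eqxx (negbTE lk) mul0r.
rewrite mxE !eqxx mul1r addr0 => /eqP; rewrite addr_eq0 => /eqP ->.
by [].
Qed.

Definition hessian (v : 'rV[R]_2) : 'M[R]_2 :=
  \matrix_(l, k) 'D_(e l) (grad k) v.

(** When the relation [normal_graph] is differentiated, the derivative of the
    null part cancels against its contribution to the product with tangent
    vectors, so only the Hessian of f remains; no second derivative of phi is
    involved. *)
Lemma second_form_graph (n : 'rV[R]_2 -> 'rV[R]_4) u :
  W u -> differentiable n u ->
  (forall w, W w -> forall v, mink (n w) ('D_v X w) = 0) ->
  'J n u *m eta R *m ('J X u)^T =
  - (null_part (n u *m A) *: ('J phi u *m hessian (phi u) *m ('J phi u)^T)).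
Proof.
move=> Wu dn nn; apply/matrixP => i j.
rewrite gramE !row_jacobian //; last exact: dX.
rewrite mink_graph_tangent //.
have dN : differentiable (fun w => n w *m A + 0) u by exact: differentiable_affine.
pose S w := null_part (n w *m A + 0).
have dS : differentiable S u by apply: differentiableB; exact: differentiable_entry.
have SE : 'D_(e i) S u = null_part ('D_(e i) n u *m A).
  rewrite -(derive_affine _ 0) // /null_part !coord_derive // /S /null_part.
  by rewrite (deriveB (f := fun w => coord (n w *m A + 0) 1)) //;
    apply: diff_derivable; exact: differentiable_entry.
have dg k : differentiable (grad k \o phi) u.
  by apply: differentiable_comp; [exact: dphi | exact/dgrad/phiD].
have tE k : tail ('D_(e i) n u *m A) k =
    - (S u * 'D_(e i) (grad k \o phi) u + grad k (phi u) * 'D_(e i) S u).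
  rewrite -(derive_affine _ 0) // /tail coord_derive //.
  transitivity ('D_(e i) (- (S * (grad k \o phi))) u).
    apply: near_eq_derive; apply: filterS (near_W Wu) => w Ww.
    rewrite -[RHS]/(- (S w * grad k (phi w))) /S addr0.
    exact: normal_graph Ww (nn w Ww) k.
  rewrite deriveN; last by apply: diff_derivable; exact: differentiableM.
  by rewrite deriveM //; exact: diff_derivable.
rewrite congruence_entry; apply: eq_bigr => k _.
rewrite tE SE derive_comp_basis; [|exact: dphi|exact/dgrad/phiD].
rewrite (JE j k Wu) /S addr0.
set T := \sum_l _; rewrite (_ : \sum_l 'J phi u i l * _ = T); last first.
  by apply: eq_bigr => l _; rewrite (JE i l Wu) [hessian _ _ _]mxE.
move: (null_part _) (null_part _) T (grad _ _) (fun_of_matrix _ _ _) => *; ring.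
Qed.

Lemma shape_op_graph (n : 'rV[R]_2 -> 'rV[R]_4) u :
  W u -> differentiable n u ->
  (forall w, W w -> forall v, mink (n w) ('D_v X w) = 0) ->
  shape_op X n u = null_part (n u *m A) *:
    ('J phi u *m hessian (phi u) *m invmx ('J phi u)).
Proof.
move=> Wu dn nn; have uJ := uphi Wu.
have uG : 'J X u *m eta R *m ('J X u)^T \in unitmx.
  by rewrite (first_form_graph Wu) unitmx_mul unitmx_tr uJ.
apply: etrans (shape_opE n uG) _.
apply: etrans (congr2 (fun a g => - (a *m invmx g))
  (second_form_graph Wu dn nn) (first_form_graph Wu)) _.
by apply: etrans (congr1 -%R (mulNmx _ _)) _; rewrite opprK; exact: congruence_over_gram.
Qed.

Lemma trace_shape_op_graph (n : 'rV[R]_2 -> 'rV[R]_4) u :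
  W u -> differentiable n u ->
  (forall w, W w -> forall v, mink (n w) ('D_v X w) = 0) ->
  \tr (shape_op X n u) = null_part (n u *m A) *
    \sum_(i < 2) 'D_(basis_vec R i) (fun w => 'D_(basis_vec R i) f w) (phi u).
Proof.
move=> Wu dn nn; rewrite shape_op_graph // mxtraceZ mxtrace_mulC mulKmx ?uphi //.
by congr (_ * _); apply: eq_bigr => i _; rewrite mxE.
Qed.

(** Relates the orientations of the parameters, of the isometry and of the
    normal frame. *)
Lemma det4_graph u l x : W u ->
  [/\ coord (l *m A) 0 = 1, coord (l *m A) 1 = 1,
      coord (l *m A) 2 = 0 & coord (l *m A) 3 = 0] ->
  det4 l x ('D_(e 0) X u) ('D_(e 1) X u) * \det A =
  null_part (x *m A) * \det ('J phi u).
Proof.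
move=> Wu lA0; rewrite -det4_mulmx.
have [_ y1 yt] := graph_tangent (e 0) Wu; have [_ z1 zt] := graph_tangent (e 1) Wu.
apply: etrans (det4_null _ lA0 y1 z1) _; congr (_ * _).
rewrite det2 (JE 0 0 Wu) (JE 0 1 Wu) (JE 1 0 Wu) (JE 1 1 Wu).
congr (_ * _ - _ * _); [exact: (yt 0) | exact: (zt 1) | exact: (yt 1) | exact: (zt 0)].
Qed.

End Graph.

(** * Null directions and reflections *)

Section Null_direction.
Context {R : realType}.
Implicit Types (l s t x y z : 'rV[R]_4).

Definition null_axis : 'rV[R]_4 := \row_i (if (i < 2)%N then 1 else 0).

Lemma coord_null_axis : [/\ coord null_axis 0 = 1, coord null_axis 1 = 1,
  coord null_axis 2 = 0 & coord null_axis 3 = 0].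
Proof. by split; rewrite /coord mxE inordK. Qed.

Lemma mink_null_axis x : mink x null_axis = null_part x.
Proof.
have [k0 k1 k2 k3] := coord_null_axis.
by rewrite mink_coord k0 k1 k2 k3 /null_part; ring.
Qed.

Lemma lorentz_unit (A : 'M[R]_4) : lorentz A -> A \in unitmx.
Proof.
move=> lA; have eA : A *m (eta R *m A^T *m eta R) = 1%:M.
  by rewrite !mulmxA lA eta_sqr.
by have [] := mulmx1_unit eA.
Qed.

Lemma null_part_mulmx (A : 'M[R]_4) l x :
  lorentz A -> l *m A = null_axis -> null_part (x *m A) = mink x l.
Proof. by move=> lA lk; rewrite -(lorentzP lA) lk mink_null_axis. Qed.

(** The reflection in the hyperplane orthogonal to v. *)
Lemma reflection_lorentz (v : 'rV[R]_4) : mink v v != 0 ->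
  let A := 1%:M - (2 / mink v v) *: (eta R *m v^T *m v) in
  lorentz A /\ forall x, x *m A = x - (2 * mink x v / mink v v) *: v.
Proof.
move=> vv A; have AE x : x *m A = x - (2 * mink x v / mink v v) *: v.
  rewrite /A mulmxBr mulmx1 -scalemxAr !mulmxA [x *m _ *m _]mx11_scalar -/(mink x v).
  by rewrite mul_scalar_mx scalerA mulrAC.
split=> //; suff mA x y : mink (x *m A) (y *m A) = mink x y.
  apply/matrixP => i j; have := gramE A A i j; rewrite /lorentz => ->.
  have rA k : row k A = row k 1%:M *m A by rewrite -row_mul mul1mx.
  by rewrite !rA mA -gramE mul1mx trmx1 mulmx1.
rewrite !AE !(minkDl, minkDr, minkNl, minkNr, minkZl, minkZr) (minkC v y).
by field.
Qed.

(** The vectors l and (1, 1, 0, 0) have the same square and the same time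
    coordinate, so their difference v is spacelike or 0, and the reflection
    along v exchanges them. *)
Lemma null_rotation l : mink l l = 0 -> coord l 0 = 1 ->
  exists2 A, lorentz A & l *m A = null_axis.
Proof.
move=> ll l0; have [k0 k1 k2 k3] := coord_null_axis.
have [->|lk] := eqVneq l null_axis.
  by exists 1%:M; rewrite ?mulmx1 // /lorentz mul1mx trmx1 mulmx1.
pose v := l - null_axis.
have kk : mink null_axis null_axis = 0 by rewrite mink_null_axis /null_part k0 k1 subrr.
have vv : mink v v = - (2 * mink l null_axis).
  by rewrite /v !(minkDl, minkDr, minkNl, minkNr) ll kk (minkC null_axis); ring.
have lv : mink l v = - mink l null_axis by rewrite /v minkDr minkNr ll; ring.
have vn : mink v v != 0.
  rewrite mink_coord; have v0 : coord v 0 = 0 by rewrite /coord !mxE -!/(coord _ 0) l0 inordK //= subrr.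
  rewrite v0 mul0r oppr0 add0r -!expr2; apply: contra lk.
  rewrite !paddr_eq0 ?addr_ge0 ?sqr_ge0 // !sqrf_eq0 => /andP[/andP[/eqP v1 /eqP v2] /eqP v3].
  rewrite -subr_eq0; apply/eqP; apply: row4P => -[|[|[|[|j]]]] // _; rewrite -/v ?v0 ?v1 ?v2 ?v3 /coord mxE //.
have [lA AE] := reflection_lorentz vn.
exists (1%:M - (2 / mink v v) *: (eta R *m v^T *m v)); first exact: lA.
have c1 : 2 * mink l v / mink v v = 1 by rewrite lv mulrN -vv mulfV.
by rewrite AE c1 scale1r /v opprB addrC subrK.
Qed.

Lemma det4_frame_combination s t y z (a c : R) :
  det4 (a *: t + c *: s) t y z = c * det4 s t y z.
Proof.
have wE v := iffLR (wedgeP t y z _) erefl v.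
have [t0 _ _] := det4_repeat t y z.
by rewrite -!wE minkDl !minkZl wE t0 mulr0 add0r.
Qed.

(** For a null l the two coordinates on the normal frame have equal squares. *)
Lemma mink_frame_combination s t l : mink t t = -1 -> mink s s = 1 -> mink s t = 0 ->
  l = - mink l t *: t + mink l s *: s -> mink l l = mink l s ^+ 2 - mink l t ^+ 2.
Proof.
move=> tt ss st lE; transitivity (mink l (- mink l t *: t + mink l s *: s)).
  by congr (mink l _).
by rewrite minkDr !minkZr; ring.
Qed.

Lemma null_combination_sign (a c d q : R) : 0 < d -> 0 < q ->
  a ^+ 2 = c ^+ 2 -> c * d = a * q -> c = a.
Proof.
move=> d0 q0 /eqP; rewrite eqf_sqr => /orP[/eqP //|/eqP ->].
rewrite mulNr => /eqP; rewrite -subr_eq0 opprK -mulrDr mulf_eq0.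
by rewrite (gt_eqF (addr_gt0 d0 q0)) orbF => /eqP ->; rewrite oppr0.
Qed.

End Null_direction.

(** * Harmonic graphs are trapped and umbilical *)

Section Converse.
Context {R : realType}.
Variables (U : set 'rV[R]_2) (X nT : 'rV[R]_2 -> 'rV[R]_4).
Hypothesis hX : spacelike_surface U X.
Hypothesis hn : future_timelike_normal U X nT.
Let nS := spacelike_normal X nT.

(** The null vector l is a multiple of n^T + n^S or of n^T - n^S. The
    determinant identity and the sign hypothesis show that its coordinates on
    n^T and n^S have the same sign, so the first case holds. *)
Lemma null_normal_orthogonal_sum u l (A : 'M[R]_4) (d : R) : U u ->
  (forall v, mink l ('D_v X u) = 0) -> mink l l = 0 ->
  det4 l (nT u) ('D_(basis_vec R 0) X u) ('D_(basis_vec R 1) X u) * \det A =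
    mink (nT u) l * d ->
  \det A * d < 0 -> mink (nT u + nS u) l = 0.
Proof.
move=> Uu lX ll dE sgn.
have [tX tt _] := timelike_normalP hX hn Uu.
have [sX ss st d0] := spacelike_normalP hX hn Uu.
have lE := normal_decomposition hX hn Uu lX.
have detE : det4 l (nT u) ('D_(basis_vec R 0) X u) ('D_(basis_vec R 1) X u) =
    mink l (nS u) * det4 (nS u) (nT u) ('D_(basis_vec R 0) X u) ('D_(basis_vec R 1) X u).
  by apply: etrans (det4_frame_combination _ _ _ _ _ _); congr det4; exact: lE.
move: detE dE d0; set p := det4 _ _ _ _; set q := det4 _ _ _ _ => -> dE q0.
have ll2 := mink_frame_combination tt ss st lE; rewrite ll in ll2.
have sq : (- mink l (nT u)) ^+ 2 = mink l (nS u) ^+ 2.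
  by rewrite sqrrN; apply/eqP; rewrite eq_sym -subr_eq0 -ll2.
have A0 : 0 < \det A ^+ 2.
  by rewrite lt0r sqr_ge0 andbT sqrf_eq0; apply: contraTneq sgn => ->; rewrite mul0r ltxx.
have dpos : 0 < q * \det A ^+ 2 by rewrite mulr_gt0.
have sgn' : 0 < - (\det A * d) by rewrite oppr_gt0.
have := null_combination_sign dpos sgn' sq.
rewrite mulrA expr2 mulrA [in X in X -> _](_ : _ * \det A = - mink l (nT u) * - (\det A * d)); last first.
  by rewrite dE (minkC (nT u)); ring.
by move=> /(_ erefl) cE; rewrite minkDl !(minkC _ l) cE addrN.
Qed.

Lemma jacobianD (f g : 'rV[R]_2 -> 'rV[R]_4) u :
  differentiable f u -> differentiable g u ->
  'J (fun w => f w + g w) u = 'J f u + 'J g u.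
Proof.
move=> df dg; apply/row_matrixP => i.
apply: etrans (row_jacobian i (differentiableD df dg)) _.
apply: etrans (deriveD (diff_derivable df) (diff_derivable dg)) _.
apply: etrans (esym (raddfD (row i) ('J f u) ('J g u))).
congr (_ + _); apply: esym; [exact: row_jacobian df | exact: row_jacobian dg].
Qed.

Lemma null_sum_differentiable u : U u -> differentiable (fun w => nT w + nS w) u.
Proof.
move=> Uu; apply: differentiableD; first exact: (timelike_differentiable hn).
exact: (spacelike_normal_differentiable hX hn).
Qed.

(** For the vector l that the isometry A sends to (1, 1, 0, 0), every shape
    operator is a multiple of a matrix similar to the Hessian of f; the
    multiple is 0 for n^T + n^S. *)
Lemma harmonic_graphs_trapped_umbilical :
  (forall u, U u -> exists (A : 'M[R]_4) (b : 'rV[R]_4),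
     lorentz A /\ harmonic_graph_near U X A b u) ->
  strongly_marginally_trapped U X nT /\ totally_umbilical U X nT.
Proof.
move=> H; suff S u : U u -> mean_curvature_vector X nT u = 0 /\
    shape_op X (fun w => nT w + nS w) u = 0%:M.
  split=> u Uu; first by have [] := S u Uu.
  by exists 0; have [] := S u Uu.
move=> Uu; have [A [b [lA [W [D [phi [f [[oW Wu WU] [oD [f2 harm]] [sphi bij uphi] XE sgn]]]]]]]] := H u Uu.
have dX w : W w -> differentiable X w by move=> /WU; exact: (surface_differentiable hX).
have dphi w : W w -> differentiable phi w by have [d _] := sphi 1%N; exact: d.
have phiD w : W w -> D (phi w) by move=> Ww; have [fD _ _] := bij; exact: fD.
have nTX w : W w -> forall v, mink (nT w) ('D_v X w) = 0.
  by move=> /WU Uw; have [] := timelike_normalP hX hn Uw.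
have nSX w : W w -> forall v, mink (nS w) ('D_v X w) = 0.
  by move=> /WU Uw; have [] := spacelike_normalP hX hn Uw.
have nX w : W w -> forall v, mink (nT w + nS w) ('D_v X w) = 0.
  by move=> /WU Uw; have [] := null_sum_normalP hX hn Uw.
have dT := timelike_differentiable hn Uu.
have dS := spacelike_normal_differentiable hX hn Uu.
have dN := null_sum_differentiable Uu.
have tT := trace_shape_op_graph lA oW dX dphi uphi phiD f2 XE Wu dT nTX.
have tS := trace_shape_op_graph lA oW dX dphi uphi phiD f2 XE Wu dS nSX.
have hN := shape_op_graph lA oW dX dphi uphi phiD f2 XE Wu dN nX.
have uA := lorentz_unit lA.
pose l := null_axis *m invmx A.
have lAk : l *m A = null_axis by rewrite mulmxKV.
have lap0 := harm _ (phiD _ Wu).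
split.
  apply: etrans (congr2 (fun a c => (2^-1 * a) *: nT u + (2^-1 * c) *: nS u) tT tS) _.
  by rewrite lap0 !mulr0 !scale0r addr0.
apply: etrans hN _; rewrite (null_part_mulmx _ lA lAk).
have [k0 k1 k2 k3] := coord_null_axis (R := R).
have lX v : mink l ('D_v X u) = 0.
  rewrite (mink_graph_tangent lA oW dX dphi phiD f2 XE) // lAk sum2 /=.
  by rewrite /null_part k0 k1 k2 k3 subrr; ring.
have ll : mink l l = 0.
  by rewrite -(lorentzP lA) lAk mink_null_axis /null_part k0 k1 subrr.
rewrite (null_normal_orthogonal_sum (A := A) (d := \det ('J phi u)) Uu lX ll).
- by rewrite scale0r raddf0.
- apply: etrans (det4_graph oW dX dphi phiD f2 XE (nT u) Wu _) _.
    by rewrite lAk; split.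
  by rewrite (null_part_mulmx _ lA lAk).
- exact: sgn.
Qed.

End Converse.

(** * The constant null direction of a trapped umbilical surface *)

Section Direct.
Context {R : realType}.
Variables (U : set 'rV[R]_2) (X nT : 'rV[R]_2 -> 'rV[R]_4).
Hypothesis hX : spacelike_surface U X.
Hypothesis hn : future_timelike_normal U X nT.
Hypothesis trapped : strongly_marginally_trapped U X nT.
Hypothesis umbilical : totally_umbilical U X nT.
Let nS := spacelike_normal X nT.
Let n (w : 'rV[R]_2) := nT w + nS w.

Lemma frame_combination0 (s t : 'rV[R]_4) (a c : R) :
  mink t t = -1 -> mink s s = 1 -> mink s t = 0 ->
  a *: t + c *: s = 0 -> a = 0 /\ c = 0.
Proof.
move=> tt ss st E; have := mink0l t; have := mink0l s; rewrite -E.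
rewrite !minkDl !minkZl tt ss st (minkC t) st; lra.
Qed.

Lemma trapped_traces u : U u ->
  \tr (shape_op X nT u) = 0 /\ \tr (shape_op X nS u) = 0.
Proof.
move=> Uu; have [_ tt _] := timelike_normalP hX hn Uu.
have [_ ss st _] := spacelike_normalP hX hn Uu.
have [a0 c0] := frame_combination0 tt ss st (trapped Uu).
have h : (2^-1 : R) != 0 by rewrite invr_eq0 pnatr_eq0.
by split; apply: (mulfI h); rewrite mulr0; [exact: a0 | exact: c0].
Qed.

Lemma null_shape_op0 u : U u -> shape_op X n u = 0.
Proof.
move=> Uu; have [k kE] := umbilical Uu; have [t0 s0] := trapped_traces Uu.
have dT := timelike_differentiable hn Uu.
have dS := spacelike_normal_differentiable hX hn Uu.
have E : shape_op X n u = shape_op X nT u + shape_op X nS u.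
  rewrite /shape_op; apply: etrans (congr1 (fun J => - (J *m _) *m _) (jacobianD dT dS)) _.
  by rewrite mulmxDl opprD mulmxDl.
have k2 : \tr (k%:M : 'M[R]_2) = 0.
  apply: etrans (congr1 mxtrace (esym kE)) _; apply: etrans (congr1 mxtrace E) _.
  apply: etrans (mxtraceD _ _) _; apply: etrans (congr1 (+%R _) s0) _.
  by rewrite addr0; exact: t0.
rewrite mxtrace_scalar in k2.
have k0 : k = 0 by move/eqP: k2; rewrite mulrn_eq0 => /eqP.
by apply: etrans kE _; rewrite k0 raddf0.
Qed.

(** The shape operator of n being 0, the tangential part of its derivatives
    vanishes. *)
Lemma null_derive_normal u i v : U u ->
  mink ('D_(basis_vec R i) n u) ('D_v X u) = 0.
Proof.
move=> Uu; have uG := first_fundamental_form_unit hX Uu.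
have dX := surface_differentiable hX Uu.
have dN := null_sum_differentiable hX hn Uu.
have B0 : 'J n u *m eta R *m ('J X u)^T = 0.
  have := etrans (esym (shape_opE n uG)) (null_shape_op0 Uu).
  move/(congr1 -%R); rewrite opprK oppr0 => /(congr1 (mulmx^~ ('J X u *m eta R *m ('J X u)^T))).
  by move=> BG; apply: etrans _ (etrans BG (mul0mx _ _)); rewrite mulmxKV.
have XE j : mink ('D_(basis_vec R i) n u) ('D_(basis_vec R j) X u) = 0.
  apply: etrans (congr2 (@mink R) (esym (row_jacobian i dN)) (esym (row_jacobian j dX))) _.
  by apply: etrans (esym (gramE _ _ i j)) _; rewrite B0 mxE.
have -> := derive_basis v dX.
have -> := sum2 (fun k => v 0 k *: 'D_(basis_vec R k) X u).
exact: (orthogonal_combination _ _ (XE 0) (XE 1)).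
Qed.

Lemma null_combination_parallel (s t x : 'rV[R]_4) :
  mink t t = -1 -> mink s s = 1 -> mink s t = 0 ->
  x = - mink x t *: t + mink x s *: s -> mink x (t + s) = 0 ->
  x = (- mink x t) *: (t + s).
Proof.
move=> tt ss st xE; rewrite minkDr => /eqP; rewrite addr_eq0 => /eqP xts.
by rewrite {1}xE scalerDr xts opprK.
Qed.

(** The derivative is normal, and orthogonal to n as n has constant square; in
    the normal plane this leaves the direction of n. *)
Lemma null_derive_parallel u i : U u ->
  exists c : R, 'D_(basis_vec R i) n u = c *: n u.
Proof.
move=> Uu; have dN := null_sum_differentiable hX hn Uu.
have [_ tt _] := timelike_normalP hX hn Uu.
have [_ ss st _] := spacelike_normalP hX hn Uu.
have xN v := null_derive_normal i v Uu.
have xE := normal_decomposition hX hn Uu xN.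
eexists; apply: (null_combination_parallel tt ss st xE).
have [_ dnn] := is_derive_mink (basis_vec R i) dN dN.
have D0 : 'D_(basis_vec R i) (fun w => mink (n w) (n w)) u = 0.
  rewrite -(derive_cst (0 : R) u (basis_vec R i)); apply: near_eq_derive.
  apply: filterS (near_surface hX Uu) => w Uw.
  by have [_ nn _ _] := null_sum_normalP hX hn Uw.
have := etrans (esym dnn) D0; rewrite (minkC (n u)).
set a := mink _ _ => aa; have a0 : a = 0 by lra.
exact: a0.
Qed.

(** Division by the time coordinate removes the scale factor left free by the
    parallelism of n and its derivatives. *)
Definition null_direction (w : 'rV[R]_2) : 'rV[R]_4 := (coord (n w) 0)^-1 *: n w.

Let m := null_direction.

Lemma null_directionP u : U u ->
  [/\ mink (m u) (m u) = 0, coord (m u) 0 = 1,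
     forall v, mink ('D_v X u) (m u) = 0 & mink (nT u) (m u) < 0].
Proof.
move=> Uu; have [nX nn nt n0] := null_sum_normalP hX hn Uu.
split.
- by rewrite /m /null_direction minkZl minkZr nn !mulr0.
- by rewrite /m /null_direction /coord mxE mulVf // gt_eqF.
- by move=> v; rewrite minkC /m /null_direction minkZl nX mulr0.
- by rewrite minkC /m /null_direction minkZl nt mulrN1 oppr_lt0 invr_gt0.
Qed.

Lemma null_direction_differentiable u : U u -> differentiable m u.
Proof.
move=> Uu; have dN := null_sum_differentiable hX hn Uu.
have [_ _ _ n0] := null_sum_normalP hX hn Uu.
apply: differentiable_mx => i j.
rewrite (_ : (fun _ => _) = (fun w => (coord (n w) 0)^-1) * (fun w => n w i j)); last first.
  by apply/funext => w; rewrite /m /null_direction mxE.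
apply: differentiableM; last exact: differentiable_entry.
apply: differentiableV; last by rewrite gt_eqF.
exact: differentiable_entry.
Qed.

(** If D_i n = c n, the quotient of an entry of n by the time coordinate has
    derivative 0. *)
Lemma null_direction_derive0 u v i j : U u -> 'D_v (fun w => m w i j) u = 0.
Proof.
move=> Uu; have dN := null_sum_differentiable hX hn Uu.
have [_ _ _ n0] := null_sum_normalP hX hn Uu.
have dm := null_direction_differentiable Uu.
rewrite derive_basis; last exact: differentiable_entry.
apply: big1 => k _; apply/eqP; rewrite mulf_eq0; apply/orP; right; apply/eqP.
have [c nE] := null_derive_parallel k Uu.
have De i' j' : 'D_(basis_vec R k) (fun w => n w i' j') u = c * n u i' j'.
  by rewrite -derive_entry // nE mxE.
have dh : differentiable (fun w => coord (n w) 0) u by exact: differentiable_entry.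
have nz : coord (n u) 0 != 0 by rewrite gt_eqF.
rewrite (_ : (fun _ => _) = (fun w => (coord (n w) 0)^-1) * (fun w => n w i j)); last first.
  by apply/funext => w; rewrite /m /null_direction mxE.
rewrite deriveM; last 2 first.
- by apply: diff_derivable; exact: differentiableV.
- by apply: diff_derivable; exact: differentiable_entry.
rewrite deriveV //; last exact: diff_derivable.
rewrite De [X in _ + _ *: (_ *: X)](De 0 (inord 0)).
rewrite /GRing.scale /= -/(coord (n u) 0).
move: (n u i j) (coord (n u) 0) nz => x y nz; field; exact: nz.
Qed.

End Direct.

(** * Trapped umbilical surfaces are harmonic graphs *)

Lemma coord_time_axis (R : realType) (c : R) :
  let b := c *: basis_vec R (inord 0 : 'I_4) in
  [/\ coord b 0 = c, coord b 1 = 0, coord b 2 = 0 & coord b 3 = 0].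
Proof. by rewrite /= !coordZ !coord_basis //= mulr1 !mulr0. Qed.

Lemma coord_graph_surface (R : realType) (f : 'rV[R]_2 -> R) v :
  [/\ coord (graph_surface f v) 0 = f v, coord (graph_surface f v) 1 = f v,
      coord (graph_surface f v) 2 = v 0 0 & coord (graph_surface f v) 3 = v 0 1].
Proof. by split; rewrite /coord mxE inordK. Qed.

Lemma eq_graph_surface (R : realType) (f : 'rV[R]_2 -> R) v (y : 'rV[R]_4) :
  f v = coord y 0 -> coord y 1 = coord y 0 -> v 0 0 = coord y 2 ->
  v 0 1 = coord y 3 -> y = graph_surface f v.
Proof.
have [g0 g1 g2 g3] := coord_graph_surface f v; move=> y0 y1 y2 y3.
by apply: row4P => -[|[|[|[|j]]]] // _; rewrite ?g0 ?g1 ?g2 ?g3 ?y1.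
Qed.

Lemma coord_translate (R : realType) (x b : 'rV[R]_4) j :
  coord b j = 0 -> coord x j = coord (x + b) j.
Proof. by rewrite coordD => ->; rewrite addr0. Qed.

Lemma null_part_translate (R : realType) (x b : 'rV[R]_4) c :
  null_part x = c -> coord b 0 = c -> coord b 1 = 0 ->
  coord (x + b) 1 = coord (x + b) 0.
Proof. by move=> <- b0 b1; rewrite !coordD b0 b1 /null_part addr0 addrC subrK. Qed.

(** Both coordinates of l on the normal frame equal the same positive number,
    which fixes the sign of its determinant with n^T and the tangent vectors. *)
Lemma orientation_sign (R : realType) (A : 'M[R]_4) (s t y z l : 'rV[R]_4) (h a d : R) :
  l = h^-1 *: t + h^-1 *: s -> 0 < h -> 0 < det4 s t y z ->
  det4 l t y z * \det A = a * d -> a < 0 -> A \in unitmx -> \det A * d < 0.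
Proof.
move=> -> h0 d0; rewrite det4_frame_combination => E a0 uA.
rewrite -(nmulr_rgt0 _ a0) mulrCA -E.
rewrite [ltRHS](_ : _ = h^-1 * det4 s t y z * \det A ^+ 2); last by ring.
apply: mulr_gt0; first by rewrite mulr_gt0 // invr_gt0.
by rewrite lt0r sqr_ge0 andbT sqrf_eq0 -unitfE -unitmxE.
Qed.

Lemma null_vector (R : realType) (y : 'rV[R]_4) :
  null_part y = 0 -> coord y 2 = 0 -> coord y 3 = 0 -> mink y y = 0.
Proof.
move=> /eqP; rewrite subr_eq0 mink_coord => /eqP -> -> ->; ring.
Qed.

(** Transfers the invariant that is propagated along a connected component
    from one point to a nearby one. *)
Lemma eq_and_value (S T : Type) (a b c : S) (F G : S -> T) (k : T) :
  a = b -> F b = G b -> (a = c /\ F c = k) <-> (b = c /\ G c = k).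
Proof. by move=> -> FG; split=> -[bc <-]; subst c; rewrite FG. Qed.

Section Graph_construction.
Context {R : realType}.
Variables (U : set 'rV[R]_2) (X nT : 'rV[R]_2 -> 'rV[R]_4).
Hypothesis hX : spacelike_surface U X.
Hypothesis hn : future_timelike_normal U X nT.
Hypothesis trapped : strongly_marginally_trapped U X nT.
Hypothesis umbilical : totally_umbilical U X nT.
Let m := null_direction X nT.

Lemma ball_in_surface q : U q -> exists2 r : R, 0 < r & ball q r `<=` U.
Proof. by move=> Uq; have /nbhs_ballP[r] := near_surface hX Uq; exists r. Qed.

Lemma null_direction_ball q r x : ball q r `<=` U -> ball q r q -> ball q r x -> m x = m q.
Proof.
move=> BU qq qx; apply/matrixP => i j.
apply: (@derive0_cst_ball _ _ (fun w => m w i j) q r) => // [w /BU Uw|w v /BU Uw].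
  by apply: differentiable_entry; exact: (null_direction_differentiable hX hn).
exact: (null_direction_derive0 hX hn trapped umbilical).
Qed.

Lemma height_ball q r x : ball q r `<=` U -> ball q r q -> ball q r x ->
  mink (X x) (m q) = mink (X q) (m q).
Proof.
move=> BU qq qx.
have dX w : ball q r w -> differentiable X w by move=> /BU; exact: (surface_differentiable hX).
have dm (w : 'rV[R]_2) : differentiable (fun=> m q) w by exact: differentiable_cst.
apply: (@derive0_cst_ball _ _ (fun w => mink (X w) (m q)) q r) => // [w qw|w v qw].
  by apply: differentiable_mink => //; exact: dX.
have [_ ->] := is_derive_mink v (dX w qw) (dm w).
rewrite derive_cst minkC mink0l add0r -(null_direction_ball BU qq qw) minkC.
by have [_ _ mX _] := null_directionP hX hn (BU _ qw); exact: mX.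
Qed.

(** The derivative of the height <X, l> vanishes where the null direction is
    l, so both constancies have to be propagated together. *)
Lemma null_direction_component p : U p -> forall q, connected_component U p q ->
  m q = m p /\ mink (X q) (m p) = mink (X p) (m p).
Proof.
move=> Up; apply: (@locally_cst_component _ U
    (fun q => m q = m p /\ mink (X q) (m p) = mink (X p) (m p))) => //.
  exact: (surface_open hX).
move=> q Uq; have [r r0 BU] := ball_in_surface Uq.
have qq : ball q r q by exact: ballxx.
apply/nbhs_ballP; exists r; [exact: r0 | move=> x qx].
have mx := null_direction_ball BU qq qx; have hx := height_ball BU qq qx.
exact: (@eq_and_value _ _ (m x) (m q) (m p) (mink (X x)) (mink (X q)) _ mx hx).
Qed.

Definition spatial_projection : 'M[R]_(4, 2) := \matrix_(i, k) (i == k.+2 :> nat)%:R.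

Lemma spatial_projectionE (x : 'rV[R]_4) k : (x *m spatial_projection) 0 k = coord x k.+2.
Proof.
have k4 : (k.+2 < 4)%N by exact: (ltn_ord k).
rewrite mxE (bigD1 (inord k.+2)) //= big1 => [|i ik].
  by rewrite mxE inordK // eqxx mulr1 addr0.
rewrite mxE; case: eqP => [ik'|_]; last by rewrite mulr0.
by case/eqP: ik; apply: val_inj; rewrite /= ik' inordK.
Qed.

(** The translation along the time axis cancels the constant value of <X, l>
    and places the surface in x_0 = x_1. There tangent vectors with zero last
    coordinates are null, hence 0, so the last two coordinates are local
    parameters. *)
Lemma trapped_umbilical_graph p (A : 'M[R]_4) q : U p -> lorentz A ->
  m p *m A = null_axis -> connected_component U p q ->
  harmonic_graph_near U X A (mink (X p) (m p) *: basis_vec R (inord 0)) q.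
Proof.
move=> Up lA mA pq; set b := _ *: _.
have [mq hq] := null_direction_component Up pq.
have Uq : U q by exact: connected_component_sub pq.
have [r r0 BU] := ball_in_surface Uq.
have qq : ball q r q by exact: ballxx.
pose B := ball q r; have oB : open B by exact: ball_open.
have mB w : B w -> m w = m p by move=> Bw; rewrite (null_direction_ball BU qq Bw).
have hB w : B w -> mink (X w) (m p) = mink (X p) (m p).
  by move=> Bw; rewrite -hq -mq; exact: height_ball Bw.
pose phi w := X w *m (A *m spatial_projection) + 0.
have sX k : Ck k B X by case: hX => _ [sX _ _ _] _; apply: Ck_sub (sX k).
have sphi : smooth_on B phi by move=> k; apply: Ck_affine => //; exact: sX.
have dX w : B w -> differentiable X w by move=> /BU; exact: (surface_differentiable hX).
have dphi w : B w -> differentiable phi w by have [d _] := sphi 1%N; exact: d.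
have Dphi w v : B w -> 'D_v phi w = 'D_v X w *m A *m spatial_projection.
  by move=> Bw; apply: etrans (derive_affine _ _ v (dX w Bw)) _; exact: mulmxA.
have nullX w v : B w -> null_part ('D_v X w *m A) = 0.
  move=> Bw; apply: etrans (null_part_mulmx _ lA mA) _; rewrite -(mB w Bw).
  by have [_ _ mX _] := null_directionP hX hn (BU _ Bw); exact: mX.
have uphi w : B w -> 'J phi w \in unitmx.
  move=> Bw; rewrite -row_free_unit; apply/inj_row_free => v vJ.
  apply/eqP; apply: contraT => v0.
  have := spacelike_tangent hX (BU _ Bw) v0; rewrite -(lorentzP lA).
  have tE (k : 'I_2) : coord ('D_v X w *m A) k.+2 = 0.
    have D0 : 'D_v X w *m A *m spatial_projection = 0.
      apply: etrans (esym (Dphi w v Bw)) _.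
      exact: etrans (deriveEjacobian v (dphi w Bw)) vJ.
    apply: etrans (esym (spatial_projectionE _ k)) _.
    by apply: etrans (congr1 (fun y : 'rV[R]_2 => y 0 k) D0) _; rewrite mxE.
  by rewrite (null_vector (nullX w v Bw) (tE 0) (tE 1)) ltxx.
have [W [psi [[oW Wq WB] oD psiK psiC]]] := local_diffeomorphism oB sphi uphi qq.
(* The height function, read in the original parameters. *)
pose f0 w := coord (X w *m A + b) 0.
pose f := f0 \o psi.
have cf2 : Ck 2 (phi @` W) f.
  have cY : Ck 2 W (fun w => X w *m A + b).
    by apply: Ck_affine; [exact: oW | exact: Ck_sub WB (sX 2%N)].
  exact: psiC (Ck_entry 0 (inord 0) oW cY).
have WU : W `<=` U by move=> w /WB; exact: BU.
have phiD w : W w -> (phi @` W) (phi w) by move=> Ww; exists w.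
have [b0 b1 b2 b3] : [/\ coord b 0 = mink (X p) (m p), coord b 1 = 0, coord b 2 = 0 & coord b 3 = 0].
  exact: coord_time_axis.
have XE w : W w -> X w *m A + b = graph_surface f (phi w).
  move=> Ww.
  have fE : f (phi w) = coord (X w *m A + b) 0 by rewrite /f /= psiK.
  have phiE (k : 'I_2) : phi w 0 k = coord (X w *m A) k.+2.
    by rewrite /phi addr0 mulmxA spatial_projectionE.
  have h : null_part (X w *m A) = mink (X p) (m p).
    by apply: etrans (null_part_mulmx _ lA mA) _; exact: hB (WB _ Ww).
  apply: eq_graph_surface; first exact: fE.
  - exact: null_part_translate h b0 b1.
  - exact: etrans (phiE 0) (coord_translate _ b2).
  - exact: etrans (phiE 1) (coord_translate _ b3).
have dXW w : W w -> differentiable X w by move=> /WB; exact: dX.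
have dphiW w : W w -> differentiable phi w by move=> /WB; exact: dphi.
have uphiW w : W w -> 'J phi w \in unitmx by move=> /WB; exact: uphi.
have mu w : W w -> null_part (nT w *m A) < 0.
  move=> Ww; rewrite (null_part_mulmx _ lA mA) -(mB w (WB _ Ww)).
  by have [_ _ _] := null_directionP hX hn (WU _ Ww); exact.
exists W, (phi @` W), phi, f; split.
- by split.
- split; [exact: oD | split; [exact: cf2 | move=> _ [w Ww <-]]].
  have dT := timelike_differentiable hn (WU _ Ww).
  have nTX w' : W w' -> forall v, mink (nT w') ('D_v X w') = 0.
    by move=> /WU Uw; have [] := timelike_normalP hX hn Uw.
  have tT := trace_shape_op_graph lA oW dXW dphiW uphiW phiD cf2 XE Ww dT nTX.
  have [t0 _] := trapped_traces hX hn trapped (WU _ Ww).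
  have := etrans (esym tT) t0 => /eqP; rewrite mulf_eq0 => /orP[|/eqP lap0]; last exact: lap0.
  by rewrite (lt_eqF (mu w Ww)).
- split; [by move=> k; exact: Ck_sub WB (sphi k) | | exact: uphiW].
  split => [w Ww|w w'|_ [w Ww <-]]; [exact: phiD Ww | | exists w; [exact: Ww | exact: erefl]].
  move=> /set_mem Ww /set_mem Ww' E.
  exact: etrans (esym (psiK w Ww)) (etrans (congr1 psi E) (psiK w' Ww')).
- exact: XE.
- move=> w Ww; have Uw := WU _ Ww.
  have [_ _ _ d0] := spacelike_normalP hX hn Uw.
  have [_ _ _ h0] := null_sum_normalP hX hn Uw.
  have mk : [/\ coord (m p *m A) 0 = 1, coord (m p *m A) 1 = 1,
      coord (m p *m A) 2 = 0 & coord (m p *m A) 3 = 0].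
    by rewrite mA; exact: coord_null_axis.
  have dE := det4_graph oW dXW dphiW phiD cf2 XE (nT w) Ww mk.
  have mE : m p = (coord (nT w + spacelike_normal X nT w) 0)^-1 *: nT w +
                  (coord (nT w + spacelike_normal X nT w) 0)^-1 *: spacelike_normal X nT w.
    by apply: etrans (esym (mB w (WB _ Ww))) _; exact: scalerDr.
  exact: orientation_sign mE h0 d0 dE (mu w Ww) (lorentz_unit lA).
Qed.

End Graph_construction.

Theorem proposition6p3 (R : realType) (U : set 'rV[R]_2)
    (X nT : 'rV[R]_2 -> 'rV[R]_4)
    (hX : spacelike_surface U X) (hn : future_timelike_normal U X nT) :
  (strongly_marginally_trapped U X nT /\ totally_umbilical U X nT) <->
  (forall p, U p ->
     exists (A : 'M[R]_4) (b : 'rV[R]_4),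
       lorentz A /\
       forall q, connected_component U p q -> harmonic_graph_near U X A b q).
Proof.
split=> [[trapped umbilical] p Up|graphs].
  have [mm m0 _ _] := null_directionP hX hn Up.
  have [A lA mA] := null_rotation mm m0.
  exists A, (mink (X p) (null_direction X nT p) *: basis_vec R (inord 0)).
  split=> [|q pq]; [exact: lA |].
  exact (trapped_umbilical_graph hX hn trapped umbilical Up lA mA pq).
apply: (harmonic_graphs_trapped_umbilical hX hn) => u Uu.
have [A [b [lA near_q]]] := graphs u Uu.
by exists A, b; split=> //; apply: near_q; exact: connected_component_refl.
Qed.
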